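(* Let $K$ be a non-Archimedean local field with residue field of cardinality $q$, let $0<\alpha<1$, $1\le p<\frac1\alpha$, and $\varphi\in L^p(K)$. Then $$ \left\|D^\alpha_\varepsilon(D^{-\alpha}\varphi)-\varphi\right\|_{L^p(K)}\longrightarrow 0\quad\text{as } \varepsilon=q^{-\nu}\to 0\ (\nu\in\mathbb N,\ \nu\to\infty). $$
   Context: $K$ is a non-Archimedean local field (a non-discrete totally disconnected locally compact topological field) with normalized absolute value $|\cdot|_K$: if $O=\{x\in K:|x|_K\le 1\}$, $P=\{x\in K:|x|_K<1\}=\beta O$, and $q$ is the cardinality of the finite residue field $O/P$, then $|\beta|_K=q^{-1}$. $dx$ is the Haar measure on the additive group of $K$ normalized so that $O$ has measure $1$; functions are complex-valued and $L^p(K)$ is taken with respect to $dx$. For $0<\alpha<1$ the Riesz potential is $$(D^{-\alpha}\varphi)(x)=d_\alpha\int_K|x-y|_K^{\alpha-1}\varphi(y)\,dy,\qquad d_\alpha=\frac{1-q^{-\alpha}}{1-q^{\alpha-1}};$$ for $\varphi\in L^p(K)$, $1\le p<1/\alpha$, it exists for almost every $x$. The truncated fractional differentiation operator is $$(D^\alpha_\varepsilon u)(x)=c_\alpha\int_{|y-x|_K\ge\varepsilon}\frac{u(y)-u(x)}{|y-x|_K^{\alpha+1}}\,dy,\qquad c_\alpha=\frac{1-q^\alpha}{1-q^{-\alpha-1}}.$$ *)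

(* Defs.v *)
From HB Require Import structures.
From mathcomp Require Import all_boot all_order all_algebra.
From mathcomp Require Import all_classical all_reals all_analysis.
From mathcomp Require Import complex.

Set Implicit Arguments.
Unset Strict Implicit.
Unset Printing Implicit Defensive.

Import Order.TTheory GRing.Theory Num.Theory.
Import numFieldNormedType.Exports.

Local Open Scope classical_set_scope.
Local Open Scope ring_scope.
Local Open Scope complex_scope.

HB.mixin Record TopologicalZmodule_isTopologicalField K
    & GRing.Field K & TopologicalZmodule K := {
  mul_field_continuous : continuous (fun z : K * K => z.1 * z.2) ;
  inv_field_continuous : forall x : K, x != 0 -> {for x, continuous (@GRing.inv K)}
}.

#[short(type="topologicalFieldType")]
HB.structure Definition TopologicalField :=
  {K of GRing.Field K & TopologicalZmodule K
      & TopologicalZmodule_isTopologicalField K}.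

(* The Hausdorff axiom is the usual convention for locally compact fields
   (here it also follows from total disconnectedness). *)
HB.mixin Record TopologicalField_isNonarchimedeanLocal K & TopologicalField K := {
  local_field_hausdorff : hausdorff_space K ;
  local_field_nondiscrete : ~ (forall A : set K, open A) ;
  local_field_totally_disconnected : totally_disconnected [set: K] ;
  local_field_locally_compact : locally_compact [set: K]
}.

#[short(type="nonarchLocalFieldType")]
HB.structure Definition NonarchimedeanLocalField :=
  {K of TopologicalField K & TopologicalField_isNonarchimedeanLocal K}.

HB.instance Definition _ (K : nonarchLocalFieldType) := isPointed.Build K 0.

(* K is equipped with its Borel sigma-algebra. *)
HB.instance Definition _ (K : nonarchLocalFieldType) :=
  Measurable.copy K (g_sigma_algebraType (@open K)).

Section AbsoluteValue.
Context {R : realType} {K : nonarchLocalFieldType}.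
Variable v : K -> R.

Definition valuation_ring : set K := [set x | v x <= 1].

Definition valuation_ideal : set K := [set x | v x < 1].

(* The quotient O/P, as the set of additive cosets x + P with x in O. *)
Definition residue_field : set (set K) :=
  [set [set x + y | y in valuation_ideal] | x in valuation_ring].

(* [v] is the normalized absolute value of K and q is the cardinality of the
   residue field: [v] is an ultrametric absolute value which defines the given
   topology of K, and a generator of the ideal P has absolute value 1/q (all
   generators of P have the same absolute value). *)
Record normalized_absolute_value (q : nat) : Prop := {
  absv_ge0 : forall x, 0 <= v x ;
  absv_eq0 : forall x, v x = 0 <-> x = 0 ;
  absvM : forall x y, v (x * y) = v x * v y ;
  absvD : forall x y, v (x + y) <= Num.max (v x) (v y) ;
  absv_nbhsE : forall (x : K) (A : set K),
    nbhs x A <-> exists2 r : R, 0 < r & [set y | v (y - x) < r] `<=` A ;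
  absv_residue_card : (residue_field #= `I_q)%card ;
  absv_normalized : exists2 b : K,
    valuation_ideal = [set b * x | x in valuation_ring] & v b = q%:R^-1
}.

End AbsoluteValue.

(* Regularity need not be required: K is a sigma-compact metrizable space, on
   which every Borel measure finite on compact sets is regular. *)
Record normalized_haar_measure {R : realType} {K : nonarchLocalFieldType}
    (v : K -> R) (mu : {measure set K -> \bar R}) :
    Prop := {
  haar_translation : forall (a : K) (A : set K), measurable A ->
    mu [set a + x | x in A] = mu A ;
  haar_compact : forall A : set K, compact A -> (mu A < +oo)%E ;
  haar_valuation_ring : mu (valuation_ring v) = 1%E
}.

Section ComplexIntegration.
Context {R : realType} {d : measure_display} {T : measurableType d}.
Variable mu : {measure set T -> \bar R}.

(* As for [Rintegral], the value is only meaningful when the real and imaginary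
   parts are integrable on D. *)
Definition Cintegral (D : set T) (f : T -> R[i]) : R[i] :=
  Rintegral mu D (fun x => complex.Re (f x)) +i*
  Rintegral mu D (fun x => complex.Im (f x)).

Definition CLnorm (p : R) (f : T -> R[i]) : \bar R :=
  Lnorm mu p%:E (fun x => (Normc.normc (f x))%:E).

Definition CLp (p : R) (f : T -> R[i]) : Prop :=
  [/\ measurable_fun [set: T] (fun x => complex.Re (f x)),
      measurable_fun [set: T] (fun x => complex.Im (f x))
    & (CLnorm p f < +oo)%E].

End ComplexIntegration.

Section FractionalOperators.
Context {R : realType} {K : nonarchLocalFieldType}.
Variables (v : K -> R) (q : nat) (mu : {measure set K -> \bar R}).

Definition riesz_const (alpha : R) : R :=
  (1 - q%:R `^ (- alpha)) / (1 - q%:R `^ (alpha - 1)).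

(* At y = x the kernel takes the value 0 (as [0 `^ a = 0] for a != 0); this
   does not matter, points being null sets. *)
Definition riesz_potential (alpha : R) (phi : K -> R[i]) (x : K) : R[i] :=
  (riesz_const alpha)%:C *
  Cintegral mu [set: K] (fun y => (v (x - y) `^ (alpha - 1))%:C * phi y).

Definition fracdiff_const (alpha : R) : R :=
  (1 - q%:R `^ alpha) / (1 - q%:R `^ (- alpha - 1)).

Definition truncated_fracdiff (alpha eps : R) (u : K -> R[i]) (x : K) : R[i] :=
  (fracdiff_const alpha)%:C *
  Cintegral mu [set y | eps <= v (y - x)]
    (fun y => (u y - u x) / (v (y - x) `^ (alpha + 1))%:C).

End FractionalOperators.

(* Main.v *)
Require Import Defs.
From HB Require Import structures.
From mathcomp Require Import all_boot all_order all_algebra.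
From mathcomp Require Import all_classical all_reals all_analysis.
From mathcomp Require Import measurable_realfun complex ring lra.

Set Implicit Arguments.
Unset Strict Implicit.
Unset Printing Implicit Defensive.

Import Order.TTheory GRing.Theory Num.Theory.
Import numFieldNormedType.Exports.

Local Open Scope classical_set_scope.
Local Open Scope ring_scope.

(** Write u for the Riesz potential of phi.  Exchanging the two integrals turns
    the truncated derivative of u at x into an integral of phi against an
    explicit kernel: up to the factor c_alpha d_alpha, the value of this kernel
    at w is the integral over the y with |y - x| >= eps of
      |y - x|^(- alpha - 1) (|y - w|^(alpha - 1) - |w - x|^(alpha - 1)).
    If |w - x| >= eps this integral is zero ([outside_kernel_far]): the
    integrand vanishes for |y - x| < |w - x| because then |y - w| = |w - x|, and
    on the rest the geometric series coming from the spheres around x and around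
    w cancel.  If |w - x| < eps, then |y - w| = |y - x| throughout, and the
    integral is elementary ([outside_kernel_near]).  So the composed operator is
    the convolution with [approx_kernel], a radial kernel supported in the ball
    of radius eps, whose integral is 1 ([approx_kernel_integral], which is where
    the values of c_alpha and d_alpha matter) and whose L^1 norm is bounded
    independently of eps ([approx_kernel_mass_le]).

    The exchange is legitimate at every x where the integral of
    |x - w|^(alpha - 1) |phi(w)| is finite, because the positive kernel that
    occurs is dominated by a multiple of |w - x|^(alpha - 1).  That integral is
    finite for almost every x ([riesz_ae_finite]); this is what p < 1 / alpha is
    needed for.

    The error at x is therefore the integral of the kernel against
    phi(w) - phi(x).  If g is constant on the balls of radius eps, phi may be
    replaced by phi - g in this formula, so that the Schur test gives
    || error ||_p <= C || phi - g ||_p with C independent of eps and g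
    ([Rerr_bound]).  Functions that are constant on the balls of some fixed
    radius are dense in L^p ([Lp_density]), and the theorem follows.

    No change of variables in an integral is ever made: all kernels depend on
    the distance only, and the only property particular to Haar measure that is
    used is that a ball whose radius r is a value of |.| has measure r
    ([haar_closed_ball]).  Since the kernels are real, the complex statement is
    the real one applied to the real and imaginary parts. *)

(** * The absolute value and its value group *)

Section AbsValue.
Context {R : realType} {K : nonarchLocalFieldType}.
Variables (v : K -> R) (q : nat).
Hypothesis hv : normalized_absolute_value v q.

Lemma absv0 : v 0 = 0. Proof. exact/(absv_eq0 hv). Qed.

Lemma absv_gt0 x : (0 < v x) = (x != 0).
Proof.
rewrite lt_def (absv_ge0 hv) andbT; apply/idP/idP; apply: contra => /eqP.
  by move=> ->; rewrite absv0.
by move/(absv_eq0 hv) => ->.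
Qed.

Lemma absv1 : v 1 = 1.
Proof.
have v1 : v 1 != 0 by rewrite gt_eqF// absv_gt0 oner_eq0.
by apply: (mulIf v1); rewrite -(absvM hv) !mul1r.
Qed.

Lemma absvN x : v (- x) = v x.
Proof.
suff vN1 : v (-1) = 1 by rewrite -mulN1r (absvM hv) vN1 mul1r.
have : v (-1) ^+ 2 = 1 by rewrite expr2 -(absvM hv) mulrNN mulr1 absv1.
by move/eqP; rewrite sqrf_eq1 => /orP[/eqP//|/eqP v1];
  have := absv_ge0 hv (-1); rewrite v1 lerNr oppr0 ler10.
Qed.

Lemma absvV x : v x^-1 = (v x)^-1.
Proof.
have [->|x0] := eqVneq x 0; first by rewrite invr0 absv0 invr0.
have vx0 : v x != 0 by rewrite gt_eqF// absv_gt0.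
by apply: (mulIf vx0); rewrite -(absvM hv) !mulVf// absv1.
Qed.

Lemma absvX x n : v (x ^+ n) = v x ^+ n.
Proof.
by elim: n => [|n ih]; rewrite ?expr0 ?absv1// !exprS (absvM hv) ih.
Qed.

Lemma absv_distC x y : v (x - y) = v (y - x).
Proof. by rewrite -absvN opprB. Qed.

Lemma absv_ultra y x z : v (x - z) <= Num.max (v (x - y)) (v (y - z)).
Proof. by rewrite -(subrKA y); exact: (absvD hv). Qed.

Lemma absv_isosceles y x z : v (x - y) < v (y - z) -> v (x - z) = v (y - z).
Proof.
move=> h; apply/eqP; rewrite eq_le; apply/andP; split.
  by apply: le_trans (absv_ultra y _ _) _; rewrite ge_max lexx andbT ltW.
have := absv_ultra x y z; rewrite le_max [v (y - x)]absv_distC.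
by rewrite leNgt h.
Qed.

Lemma q_gt1 : (1 < q)%N.
Proof.
have [b Pb vb] := absv_normalized hv.
have vb1 : v b < 1.
  suff : valuation_ideal v b by [].
  by rewrite Pb; exists 1; rewrite ?mulr1//= /valuation_ring/= absv1.
have := absv_residue_card hv; move: vb vb1; case: q => [|[|//]].
  move=> _ _ /card_set_bijP[f bijf].
  have : residue_field v [set 0 + y | y in valuation_ideal v].
    by exists 0 => //=; rewrite /valuation_ring/= absv0.
  by move=> h; have := set_bij_sub bijf (imageP f h).
by move=> ->; rewrite invr1 ltxx.
Qed.

Let q_gt0 : 0 < q%:R :> R.
Proof. by rewrite ltr0n (ltn_trans _ q_gt1). Qed.

(** Radii are restricted to values of v on nonzero elements, because a ball of
    any other radius has a measure different from its radius. *)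
Definition is_value r := exists2 c, c != 0 & v c = r.

Lemma uniformizer : exists2 b, v b = q%:R^-1 & forall x, v x < 1 -> v x <= v b.
Proof.
have [b Pb vb] := absv_normalized hv; exists b => // x x1.
have : valuation_ideal v x by [].
by rewrite Pb => -[y /= y1 <-]; rewrite (absvM hv) ler_piMr// (absv_ge0 hv).
Qed.

(** The ideal P is generated by an element of absolute value 1 / q, so
    no absolute value lies strictly between 1 / q and 1; scaling by c gives the
    gap below v c. *)
Lemma absv_discrete c x : v x < v c -> v x <= v c / q%:R.
Proof.
move=> xc; have [b <- hb] := uniformizer.
have c0 : 0 < v c by apply: le_lt_trans xc; exact: (absv_ge0 hv).
rewrite mulrC -ler_pdivrMr// -absvV -(absvM hv); apply: hb.
by rewrite (absvM hv) absvV ltr_pdivrMr// mul1r.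
Qed.

Lemma value_gt0 r : is_value r -> 0 < r.
Proof. by move=> [c c0 <-]; rewrite absv_gt0. Qed.

Lemma is_value1 : is_value 1.
Proof. by exists 1; rewrite ?oner_eq0 ?absv1. Qed.

Lemma is_value_divq r : is_value r -> is_value (r / q%:R).
Proof.
move=> [c c0 <-]; have [b vb _] := uniformizer; exists (c * b).
  by rewrite mulf_neq0// -absv_gt0 vb invr_gt0.
by rewrite (absvM hv) vb.
Qed.

Lemma is_value_mulq r : is_value r -> is_value (r * q%:R).
Proof.
move=> [c c0 <-]; have [b vb _] := uniformizer; exists (c / b).
  by rewrite mulf_neq0// invr_eq0 -absv_gt0 vb invr_gt0.
by rewrite (absvM hv) absvV vb invrK.
Qed.

Lemma is_value_divqX r n : is_value r -> is_value (r * q%:R ^- n).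
Proof.
elim: n => [|n ih]; first by rewrite expr0 invr1 mulr1.
by move/ih/is_value_divq; rewrite -mulrA -invfM -exprSr.
Qed.

Lemma is_value_mulqX r n : is_value r -> is_value (r * q%:R ^+ n).
Proof.
elim: n => [|n ih]; first by rewrite expr0 mulr1.
by move/ih/is_value_mulq; rewrite -mulrA -exprSr.
Qed.

Lemma is_value_qX n : is_value (q%:R ^+ n).
Proof. by rewrite -[X in is_value X]mul1r; exact/is_value_mulqX/is_value1. Qed.

Lemma is_value_qVX n : is_value (q%:R ^- n).
Proof. by rewrite -[X in is_value X]mul1r; exact/is_value_divqX/is_value1. Qed.

Lemma qX_gt (r : R) : exists n, r < q%:R ^+ n.
Proof.
exists (Num.bound `|r|); apply: (@lt_trans _ _ (Num.bound `|r|)%:R).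
  exact: le_lt_trans (ler_norm r) (archi_boundP (normr_ge0 r)).
by rewrite -natrX ltr_nat ltn_expl// q_gt1.
Qed.

Lemma qVX_lt (r : R) : 0 < r -> exists n, q%:R ^- n < r.
Proof.
move=> r0; have [n hn] := qX_gt r^-1; exists n.
by rewrite invf_plt ?posrE ?exprn_gt0.
Qed.

(** By [absv_discrete] no absolute value lies strictly between two consecutive
    powers of q.  The search descends from 1; the case v c > 1 is that of the
    inverse. *)
Lemma is_valueP r : is_value r ->
  exists n, r = q%:R ^+ n \/ r = q%:R ^- n.
Proof.
move=> [c c0 <-].
have down x k : v x <= 1 -> q%:R ^- k < v x -> exists n, v x = q%:R ^- n.
  move=> x1; elim: k => [|k ih]; first by rewrite expr0 invr1 ltNge x1.
  have [kx _|] := ltP (q%:R ^- k) (v x); first exact: ih.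
  rewrite le_eqVlt => /predU1P[-> _|xk kx]; first by exists k.
  have [d d0 vd] : is_value (q%:R ^- k).
    exact: is_value_qVX.
  rewrite -vd in xk; have := absv_discrete xk.
  by rewrite vd -invfM -exprSr leNgt kx.
have [c1|/ltW c1] := leP (v c) 1.
  have [k hk] : exists k, q%:R ^- k < v c by apply: qVX_lt; rewrite absv_gt0.
  by have [n] := down c k c1 hk; exists n; right.
have vc1 : v c^-1 <= 1.
  by rewrite absvV invf_le1// absv_gt0.
have [k hk] : exists k, q%:R ^- k < v c^-1.
  by apply: qVX_lt; rewrite absv_gt0 invr_eq0.
by have [n] := down _ k vc1 hk; rewrite absvV => /invr_inj vE; exists n; left.
Qed.

End AbsValue.

(** * Measurability of the distance, and the Haar measure of balls *)

Section Balls.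
Context {R : realType} {K : nonarchLocalFieldType}.
Variables (v : K -> R) (q : nat).
Hypothesis hv : normalized_absolute_value v q.

Let q_gt0 : 0 < q%:R :> R.
Proof. by rewrite ltr0n (ltn_trans _ (q_gt1 hv)). Qed.

(** Representatives of O / P indexed by the integers below q; they play
    the part of digits. *)
Lemma residue_representatives : exists g : nat -> K,
  [/\ forall i, (i < q)%N -> v (g i) <= 1,
      forall x, v x <= 1 -> exists2 i, (i < q)%N & v (x - g i) < 1 &
      forall i j, (i < q)%N -> (j < q)%N -> v (g i - g j) < 1 -> i = j].
Proof.
have /card_set_bijP[f bijf] := absv_residue_card hv.
pose coset (x : K) := [set x + y | y in valuation_ideal v].
have fP x : v x <= 1 -> (f (coset x) < q)%N.
  by move=> x1; apply: (set_bij_sub bijf); exists (coset x) => //; exists x.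
have cosetP x y : v (x - y) < 1 -> coset x = coset y.
  move=> xy; apply/seteqP; split=> _ [z z1 <-] /=.
    exists (x - y + z); last by rewrite addrA subrKC.
    by apply: le_lt_trans (absvD hv _ _) _; rewrite gt_max xy.
  exists (y - x + z); last by rewrite addrA subrKC.
  by apply: le_lt_trans (absvD hv _ _) _; rewrite gt_max (absv_distC hv) xy.
have /choice[g gP] : forall i, exists x,
    (i < q)%N -> v x <= 1 /\ f (coset x) = i.
  move=> i; have [iq|_] := ltnP i q; last by exists 0.
  by have [_ [x x1 <-] <-] := set_bij_surj bijf iq; exists x.
exists g; split => [i /gP[]//|x x1|i j iq jq /cosetP gij].
  exists (f (coset x)); first exact: fP.
  have [g1 /(set_bij_inj bijf) gE] := gP _ (fP _ x1).
  have : coset x x by exists 0; rewrite ?addr0//= /valuation_ideal/= (absv0 hv).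
  rewrite -{1}gE ?inE; [|by exists (g (f (coset x)))|by exists x].
  by move=> [y y1 gy]; rewrite -{1}gy addrAC subrr add0r.
by have [_ <-] := gP _ iq; have [_ <-] := gP _ jq; rewrite gij.
Qed.

(** Finite expansions in powers of a uniformizer, with digits among the
    representatives of O / P and finitely many negative powers, are countable and
    approximate every element. *)
Lemma dense_sequence : exists D : nat -> K,
  forall x r, 0 < r -> exists n, v (x - D n) < r.
Proof.
have [g [g1 gP _]] := residue_representatives.
have [b vb _] := uniformizer hv.
have b0 : b != 0 by rewrite -(absv_gt0 hv) vb invr_gt0.
(* Horner scheme: the first digit has weight 1, the next one weight b. *)
pose digits (s : seq nat) := foldr (fun d a => g d + b * a) 0 s.
pose D (n : nat) : K :=
  if unpickle n is Some (m, s) then b ^- m * digits s else 0.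
exists D => x r r0.
have [m hm] : exists m, v x < q%:R ^+ m by exact: (qX_gt hv).
have x1 : v (b ^+ m * x) <= 1.
  by rewrite (absvM hv) (absvX hv) vb exprVn mulrC ler_pdivrMr ?exprn_gt0// mul1r ltW.
have [k hk] : exists k, q%:R ^- k < r / q%:R ^+ m.
  by apply: (qVX_lt hv); rewrite divr_gt0// exprn_gt0.
have approx : forall k y, v y <= 1 -> exists s, v (y - digits s) <= q%:R ^- k.
  elim=> [|l ih] y y1; first by exists [::]; rewrite subr0 expr0 invr1.
  have [i iq yi] := gP _ y1.
  have [|s hs] := ih ((y - g i) / b).
    rewrite (absvM hv) (absvV hv) vb invrK.
    have : v (y - g i) < v 1 by rewrite (absv1 hv).
    by move/(absv_discrete hv); rewrite ler_pdivlMr// (absv1 hv).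
  exists (i :: s) => /=.
  have -> : y - (g i + b * digits s) = b * ((y - g i) / b - digits s).
    by rewrite mulrBr mulrCA mulfV// mulr1 opprD addrA.
  by rewrite (absvM hv) vb exprS invfM ler_pM2l ?invr_gt0.
have [s hs] := approx k _ x1.
exists (pickle (m, s)); rewrite /D pickleK.
have -> : x - b ^- m * digits s = b ^- m * (b ^+ m * x - digits s).
  by rewrite mulrBr mulKf// expf_neq0.
rewrite (absvM hv) (absvV hv) (absvX hv) vb exprVn invrK.
by rewrite mulrC -ltr_pdivlMr ?exprn_gt0//; exact: le_lt_trans hk.
Qed.

Lemma open_ball_open a r : open [set y | v (y - a) < r].
Proof.
rewrite openE => x /= xr; apply/(absv_nbhsE hv).
exists r; first by apply: le_lt_trans xr; exact: (absv_ge0 hv).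
move=> y /= yr; apply: le_lt_trans (absv_ultra hv x _ _) _.
by rewrite gt_max yr.
Qed.

Lemma measurable_open (A : set K) : open A -> measurable A.
Proof. by move=> oA; exact: sub_sigma_algebra. Qed.

(** Measurability for the product sigma-algebra rests on separability: the
    set of pairs at distance < r is the countable union of the squares of the
    balls of radius r around the points of a dense sequence. *)
Lemma measurable_absv_dist :
  measurable_fun [set: K * K] (fun xy => v (xy.1 - xy.2)).
Proof.
have [D hD] := dense_sequence.
apply: (measurability _ (RGenInftyO.measurableE R)) => //.
move=> _ [_ [r ->] <-]; rewrite setTI.
have [r0|r0] := leP r 0.
  rewrite [X in measurable X](_ : _ = set0)//; apply/seteqP; split=> // xy /=.
  by rewrite in_itv/= ltNge (le_trans r0)// (absv_ge0 hv).
rewrite [X in measurable X](_ : _ = \bigcup_n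
    ([set x | v (x - D n) < r] `*` [set x | v (x - D n) < r])).
  by apply: bigcupT_measurable => n; apply: measurableX; apply: measurable_open;
    apply: open_ball_open.
apply/seteqP; split=> [[x y]|[x y] [n _ []]] /=; rewrite in_itv/=.
  move=> xyr; have [n xn] := hD x _ r0; exists n => //; split=> //=.
  apply: le_lt_trans (absv_ultra hv x _ _) _.
  by rewrite (absv_distC hv) gt_max xyr.
move=> xn yn; apply: le_lt_trans (absv_ultra hv (D n) _ _) _.
by rewrite [v (D n - y)](absv_distC hv) gt_max xn.
Qed.

Lemma measurable_absvBr a : measurable_fun [set: K] (fun x => v (x - a)).
Proof.
apply: (measurableT_comp measurable_absv_dist (_ : measurable_fun _ (fun x => (x, a)))).
exact: measurable_fun_pair.
Qed.

Lemma measurable_absv_preimage a (A : set R) : measurable A ->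
  measurable [set y | A (v (y - a))].
Proof.
move=> mA; rewrite -[X in measurable X]setTI.
exact: (measurable_absvBr a).
Qed.

Lemma measurable_closed_ball a r : measurable [set y | v (y - a) <= r].
Proof.
rewrite (_ : mkset _ = [set y | `]-oo, r]%classic (v (y - a))]).
  exact: (measurable_absv_preimage a (measurable_itv `]-oo, r])).
by apply/seteqP; split=> y /=; rewrite in_itv.
Qed.

Lemma measurable_open_ball a r : measurable [set y | v (y - a) < r].
Proof. by apply: measurable_open; apply: open_ball_open. Qed.

Variable mu : {measure set K -> \bar R}.
Hypothesis hmu : normalized_haar_measure v mu.

Lemma haar_open_ballC a r :
  mu [set y | v (y - a) < r] = mu [set y | v y < r].
Proof.
rewrite -(@haar_translation _ _ _ _ hmu a [set y | v y < r]); last first.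
  rewrite (_ : [set y | v y < r] = [set y | v (y - 0) < r]).
    exact: measurable_open_ball.
  by apply/seteqP; split=> y /=; rewrite subr0.
congr (mu _); apply/seteqP; split=> [x xr|_ [x xr <-]] /=.
  by exists (x - a) => //; rewrite subrKC.
by rewrite addrAC subrr add0r.
Qed.

(** A closed ball is the disjoint union of q open balls of the same
    radius, one for each element of O / P, and these are translates of each other. *)
Lemma haar_ball_split c a : c != 0 ->
  mu [set y | v (y - a) <= v c] = ((q%:R)%:E * mu [set y | (v y < v c)%R])%E.
Proof.
move=> c0; have vc0 : 0 < v c by rewrite (absv_gt0 hv).
have [g [g1 gP g_inj]] := residue_representatives.
pose F (i : nat) := [set y | v (y - (a + c * g i)) < v c].
have -> : [set y | v (y - a) <= v c] = \bigcup_(i in `I_q) F i.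
  apply/seteqP; split=> [y /= ya|y [i /= iq yi]].
    have [|i iq hi] := gP ((y - a) / c).
      by rewrite (absvM hv) (absvV hv) ler_pdivrMr// mul1r.
    exists i => //; rewrite /F/=.
    have -> : y - (a + c * g i) = c * ((y - a) / c - g i).
      by rewrite mulrBr mulrCA mulfV// mulr1 opprD addrA.
    by rewrite (absvM hv) gtr_pMr.
  apply: le_trans (absv_ultra hv (a + c * g i) _ _) _; rewrite ge_max ltW//=.
  by rewrite addrAC subrr add0r (absvM hv) ler_piMr ?g1 ?(absv_ge0 hv).
rewrite measure_fin_bigcup//; last 2 first.
- move=> i j; rewrite /mkset => iq jq [y [/= yi yj]]; apply: (g_inj _ _ iq jq).
  have : v (c * (g i - g j)) < v c.
    have -> : c * (g i - g j) = (a + c * g i) - (a + c * g j) by ring.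
    apply: le_lt_trans (absv_ultra hv y _ _) _.
    by rewrite (absv_distC hv) gt_max yi.
  by rewrite (absvM hv) gtr_pMr.
- by move=> i _; exact: measurable_open_ball.
rewrite (eq_fsbigr (fun=> mu [set y | v y < v c])); last by move=> i _;
  exact: haar_open_ballC.
rewrite -fsbig_ord.
by rewrite sumr_const card_ord mule_natl.
Qed.

(** By [haar_ball_split], dividing the radius by q divides the measure
    by q; the unit ball has measure 1, and every value is a power of q. *)
Lemma haar_closed_ball r a : is_value v r ->
  mu [set y | v (y - a) <= r] = r%:E.
Proof.
have half c : c != 0 -> mu [set y | v y < v c] =
    mu [set y | v y <= v c / q%:R].
  move=> c0; congr (mu _); apply/seteqP; split=> y /=.
    exact: (absv_discrete hv).
  move=> /le_lt_trans; apply; rewrite gtr_pMr ?(absv_gt0 hv)//.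
  by rewrite invf_lt1// ltr1n (q_gt1 hv).
have step c a' : c != 0 -> mu [set y | v (y - a') <= v c] =
    (q%:R%:E * mu [set y | (v y <= v c / q%:R)%R])%E.
  by move=> c0; rewrite haar_ball_split// half.
have step0 c : c != 0 -> mu [set y | v y <= v c] =
    (q%:R%:E * mu [set y | (v y <= v c / q%:R)%R])%E.
  move=> c0; rewrite -(step c 0 c0); congr (mu _).
  by apply/seteqP; split=> y /=; rewrite subr0.
have one : mu [set y | v y <= 1] = 1%E by exact: (haar_valuation_ring hmu).
have centered c : c != 0 -> mu [set y | v y <= v c] = (v c)%:E.
  have up n : mu [set y | v y <= q%:R ^+ n] = (q%:R ^+ n)%:E.
    elim: n => [|n ih]; first by rewrite expr0 one.
    have [c' c'0 vc] : is_value v (q%:R ^+ n.+1).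
      exact: (is_value_qX hv).
    have := step0 c' c'0.
    by rewrite vc exprSr mulfK ?gt_eqF// ih => ->; rewrite -EFinM mulrC.
  have down n : mu [set y | v y <= q%:R ^- n] = (q%:R ^- n)%:E.
    elim: n => [|n ih]; first by rewrite expr0 invr1 one.
    have [c' c'0 vc] : is_value v (q%:R ^- n).
      exact: (is_value_qVX hv).
    have := step0 c' c'0.
    rewrite vc ih -invfM -exprSr => h.
    have : (q%:R^-1%:E * (q%:R ^- n)%:E =
       q%:R^-1%:E * (q%:R%:E * mu [set y | (v y <= q%:R ^- n.+1)%R]))%E by rewrite -h.
    rewrite muleA -!EFinM mulVf ?gt_eqF// mul1e => <-.
    by rewrite -invfM -exprS.
  move=> c0; have [n [->|->]] : exists n, v c = q%:R ^+ n \/ v c = q%:R ^- n.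
    by apply: (is_valueP hv); exists c.
  - exact: up.
  - exact: down.
move=> [c c0 <-]; rewrite step//.
have [d d0 vd] : is_value v (v c / q%:R) by apply: (is_value_divq hv); exists c.
by rewrite -vd centered// vd -EFinM mulrC divfK// gt_eqF.
Qed.

End Balls.

(** * Integrals of powers of the distance to a point *)

Lemma nneseries_geometric (R : realType) (A x : R) : 0 <= A -> 0 <= x < 1 ->
  (\sum_(i <oo) (A * x ^+ i)%:E = (A / (1 - x))%:E)%E.
Proof.
move=> A0 /andP[x0 x1]; apply/cvg_lim => //.
have -> : (fun n => \sum_(0 <= i < n) (A * x ^+ i)%:E)%E =
    EFin \o series (geometric A x).
  by apply/funext => n /=; rewrite /series/= sumEFin.
by apply: cvg_EFin; [exact: nearW|apply: cvg_geometric_series; rewrite ger0_norm].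
Qed.

Section Radial.
Context {R : realType} {K : nonarchLocalFieldType}.
Variables (v : K -> R) (q : nat).
Hypothesis hv : normalized_absolute_value v q.
Variable mu : {measure set K -> \bar R}.
Hypothesis hmu : normalized_haar_measure v mu.

Let Q : R := q%:R.

Let Q_gt1 : 1 < Q. Proof. by rewrite ltr1n (q_gt1 hv). Qed.
Let Q_gt0 : 0 < Q. Proof. exact: lt_trans Q_gt1. Qed.

Lemma haar_sigma_finite : sigma_finite [set: K] mu.
Proof.
exists (fun n => [set y | v (y - 0) <= Q ^+ n]).
  apply/seteqP; split=> // y _; have [n /ltW hn] := qX_gt hv (v y).
  by exists n => //=; rewrite subr0.
move=> n; split; first exact: (measurable_closed_ball hv).
rewrite (haar_closed_ball hv hmu) ?ltry//.
exact: (is_value_qX hv).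
Qed.

Lemma measurable_center a : measurable ([set a] : set K).
Proof.
rewrite (_ : [set a] = [set y | v (y - a) <= 0]).
  exact: (measurable_closed_ball hv).
apply/seteqP; split=> y /= => [->|]; first by rewrite subrr (absv0 hv).
rewrite le_eqVlt ltNge (absv_ge0 hv) orbF => /eqP/(absv_eq0 hv)/eqP.
by rewrite subr_eq0 => /eqP.
Qed.

Lemma haar_center a : mu [set a] = 0%E.
Proof.
apply/eqP; rewrite eq_le measure_ge0 andbT; apply/lee_addgt0Pr => e e0.
rewrite add0e; have [n /ltW hn] := qVX_lt hv e0.
apply: le_trans (_ : (Q ^- n)%:E <= _)%E; last by rewrite lee_fin.
rewrite -(haar_closed_ball hv hmu a (r := Q ^- n)); last first.
  exact: (is_value_qVX hv).
apply: le_measure; rewrite ?inE;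
  [exact: measurable_center|exact: (measurable_closed_ball hv)|].
by move=> _ /= ->; rewrite subrr (absv0 hv) invr_ge0 exprn_ge0// ltW.
Qed.

Lemma haar_open_ball r a : is_value v r ->
  mu [set y | v (y - a) < r] = (r / Q)%:E.
Proof.
move=> vr; rewrite -(haar_closed_ball hv hmu a (r := r / Q));
  last exact: (is_value_divq hv).
congr (mu _); case: vr => c c0 <-; apply/seteqP; split=> y /=.
  exact: (absv_discrete hv).
move=> /le_lt_trans; apply; rewrite gtr_pMr ?(absv_gt0 hv)//.
by rewrite invf_lt1.
Qed.

Lemma measurable_sphere a r : measurable [set y | v (y - a) = r].
Proof.
exact: (measurable_absv_preimage hv a (measurable_set1 r)).
Qed.

Lemma haar_sphere r a : is_value v r ->
  mu [set y | v (y - a) = r] = (r * (1 - Q^-1))%:E.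
Proof.
move=> vr; have := haar_closed_ball hv hmu a vr.
have -> : [set y | v (y - a) <= r] = [set y | v (y - a) = r] `|` [set y | v (y - a) < r].
  apply/seteqP; split=> y /=; rewrite le_eqVlt; first by move/predU1P.
  by case=> ->; rewrite ?eqxx ?orbT.
rewrite measureU; [|exact: measurable_sphere|exact: (measurable_open_ball hv)|];
  last first.
  by apply/seteqP; split=> // y /= [->]; rewrite ltxx.
rewrite [X in (_ + X)%E](haar_open_ball a vr) => h.
rewrite mulrBr mulr1 EFinB -h; exact/esym/addeK.
Qed.

Lemma measurable_absv_powR a t :
  measurable_fun [set: K] (fun y => v (y - a) `^ t).
Proof. exact: (measurableT_comp (measurable_powR t) (measurable_absvBr hv a)). Qed.

(** Integrating over spheres whose radii form a geometric sequence gives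
    a geometric series; x = 1 / q sums over a punctured ball and x = q over the
    outside of a ball. *)
Lemma integral_spheres a r x t : 0 < x -> x != 1 -> x `^ (t + 1) < 1 ->
  (forall i, is_value v (r * x ^+ i)) ->
  (\int[mu]_(y in \bigcup_i [set y | (v (y - a) = r * x ^+ i)%R]) (v (y - a) `^ t)%:E
   = ((1 - Q^-1) * r `^ (t + 1) / (1 - x `^ (t + 1)))%:E)%E.
Proof.
move=> x0 x1 xt rx.
have r0 : 0 < r by have /(value_gt0 hv) := rx 0; rewrite expr0 mulr1.
have mt : measurable_fun [set: K] (fun y => (v (y - a) `^ t)%:E).
  by apply/measurable_EFinP; exact: measurable_absv_powR.
rewrite ge0_integral_bigcup; first last.
- move=> i j _ _ [y [/= -> /(mulfI (lt0r_neq0 r0))]].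
  by move=> /(ieexprIn x0 x1).
- by move=> y _; rewrite lee_fin powR_ge0.
- exact: measurable_funTS.
- by move=> i; exact: measurable_sphere.
rewrite -nneseries_geometric; last 2 first.
- by rewrite mulr_ge0 ?powR_ge0// subr_ge0 invf_le1// ltW.
- by rewrite powR_ge0.
apply: eq_eseriesr => i _.
rewrite (eq_integral (cst (((r * x ^+ i) `^ t)%:E))); last first.
  by move=> y; rewrite inE/= => ->.
rewrite integral_cst; last exact: measurable_sphere.
rewrite haar_sphere// -EFinM; congr EFin.
have rx0 : 0 < r * x ^+ i by rewrite mulr_gt0// exprn_gt0.
rewrite mulrA [LHS]mulrC -[RHS]mulrA; congr (_ * _).
rewrite -[X in _ * X = _](powRr1 (ltW rx0)) -powRD; last by rewrite (gt_eqF rx0) implybT.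
rewrite powRM ?exprn_ge0 ?ltW//; congr (_ * _).
by rewrite -!powR_mulrn ?powR_ge0 ?ltW// -!powRrM mulrC.
Qed.

Lemma is_value_ratio r r' : is_value v r -> is_value v r' ->
  exists n, r = r' * Q ^+ n \/ r = r' * Q^-1 ^+ n.
Proof.
move=> [c c0 <-] [c' c'0 <-].
have [n h] : exists n, v (c / c') = Q ^+ n \/ v (c / c') = Q ^- n.
  by apply: (is_valueP hv); exists (c / c') => //; rewrite mulf_neq0// invr_eq0.
exists n; have vc' : v c' != 0 by rewrite gt_eqF// (absv_gt0 hv).
by rewrite exprVn; case: h => <-; [left|right];
  rewrite (absvM hv) (absvV hv) mulrC divfK.
Qed.

Lemma is_value_dist y a : y != a -> is_value v (v (y - a)).
Proof. by exists (y - a) => //; rewrite subr_eq0. Qed.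

Lemma integral_closed_ball a r t : 0 < t + 1 -> is_value v r ->
  (\int[mu]_(y in [set y | (v (y - a) <= r)%R]) (v (y - a) `^ t)%:E =
   ((1 - Q^-1) * r `^ (t + 1) / (1 - Q `^ (- (t + 1))))%:E)%E.
Proof.
move=> t1 vr; have r0 := value_gt0 hv vr.
rewrite (@ge0_negligible_integral _ _ _ _ _ [set a]); last 5 first.
- exact: measurable_center.
- exact: (measurable_closed_ball hv).
- by apply: measurable_funTS; apply/measurable_EFinP; exact: measurable_absv_powR.
- by move=> y _; rewrite lee_fin powR_ge0.
- exact: haar_center.
(* The radii are r x^i with x = 1 / q. *)
have -> : Q `^ (- (t + 1)) = Q^-1 `^ (t + 1).
  by rewrite -powR_inv1 ?ltW// -powRrM mulN1r.
rewrite -(@integral_spheres a); first last.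
- by move=> i; rewrite exprVn; exact: (is_value_divqX hv).
- apply: (@lt_le_trans _ _ (1 `^ (t + 1))); last by rewrite powR1.
  apply: gt0_ltr_powR; rewrite ?nnegrE//.
    by rewrite invr_ge0 ltW.
  by rewrite invf_lt1.
- by rewrite lt_eqF// invf_lt1.
- by rewrite invr_gt0.
congr integral; apply/seteqP; split=> y /=.
  move=> [yr /eqP ya]; have [n [yE|yE]] := is_value_ratio (is_value_dist ya) vr.
    exists 0%N => //=; apply/eqP; rewrite expr0 mulr1 eq_le yr /=.
    by rewrite yE ler_peMr ?(ltW r0)// exprn_ege1// ltW.
  by exists n.
move=> [i _ /= yE]; split.
  by rewrite yE ler_piMr ?(ltW r0)// exprn_ile1 ?invr_ge0 ?invf_le1// ltW.
move=> /= ya; move: yE; rewrite ya subrr (absv0 hv) => /esym/eqP.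
by rewrite gt_eqF// mulr_gt0// exprn_gt0// invr_gt0.
Qed.

Lemma integral_outside_ball a r t : t + 1 < 0 -> is_value v r ->
  (\int[mu]_(y in [set y | (r <= v (y - a))%R]) (v (y - a) `^ t)%:E =
   ((1 - Q^-1) * r `^ (t + 1) / (1 - Q `^ (t + 1)))%:E)%E.
Proof.
move=> t1 vr; have r0 := value_gt0 hv vr.
rewrite -(@integral_spheres a)//; first last.
- by move=> i; exact: (is_value_mulqX hv).
- by rewrite /powR gt_eqF// expR_lt1 pmulr_llt0// ln_gt0.
- by rewrite gt_eqF.
congr integral; apply/seteqP; split=> y /=.
  move=> yr; have ya : y != a.
    by apply: contraTneq yr => ->; rewrite subrr (absv0 hv) -ltNge.
  have [n [yE|yE]] := is_value_ratio (is_value_dist ya) vr; first by exists n.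
  exists 0%N => //=; apply/eqP; rewrite expr0 mulr1 eq_le yr andbT.
  by rewrite yE ler_piMr ?(ltW r0)// exprn_ile1 ?invr_ge0 ?invf_le1// ltW.
move=> [i _ /= ->].
by rewrite ler_peMr ?(ltW r0)// exprn_ege1// ltW.
Qed.

End Radial.

(** * The Schur test *)

Section Schur.
Local Open Scope ereal_scope.
Context {R : realType} {d : measure_display} {T : measurableType d}.

(** The weak form of Young's inequality used in [jensen_powR]: compare t
    with the threshold lam. *)
Lemma le_threshold (p lam t : R) : (1 <= p)%R -> (0 < lam)%R -> (0 <= t)%R ->
  (t <= lam + lam `^ (1 - p) * t `^ p)%R.
Proof.
move=> p1 lam0 t0; have [tl|lt] := leP t lam.
  by rewrite (le_trans tl)// lerDl mulr_ge0 ?powR_ge0.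
have t0' : (0 < t)%R by exact: lt_trans lt.
apply: (@le_trans _ _ (lam `^ (1 - p) * t `^ p))%R; last by rewrite lerDr ltW.
rewrite -(mulr_powRB1 t0 (lt_le_trans ltr01 p1)).
rewrite mulrCA ler_peMr//.
have -> : (1 - p = - (p - 1))%R by rewrite opprB.
rewrite powRN ler_pdivlMl ?powR_gt0// mulr1.
by apply: ge0_ler_powR; rewrite ?nnegrE ?subr_ge0// ltW.
Qed.

(** Jensen's inequality up to a constant.  Integrating [le_threshold] against
    k gives the bound lam M + lam^(1-p) S, S being the integral of k h^p, and the
    choice lam = (S / M)^(1/p) balances the two terms.  Since S may vanish, S is
    replaced by a larger real number s. *)
Lemma jensen_powR (mu : {measure set T -> \bar R}) (k h : T -> R) (M p : R) :
  (1 <= p)%R -> (0 < M)%R ->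
  measurable_fun [set: T] k -> (forall x, 0 <= k x)%R ->
  \int[mu]_x (k x)%:E <= M%:E ->
  measurable_fun [set: T] h -> (forall x, 0 <= h x)%R ->
  (\int[mu]_x (k x * h x)%:E) `^ p <=
    ((2 * M) `^ p / M)%:E * \int[mu]_x (k x * h x `^ p)%:E.
Proof.
move=> p1 M0 mk k0 kM mh h0.
have p0 : (0 < p)%R by exact: lt_le_trans p1.
have c0 : (0 < (2 * M) `^ p / M)%R by rewrite divr_gt0// powR_gt0// mulr_gt0.
have mkh : measurable_fun [set: T] (fun x => (k x * h x)%:E).
  by apply/measurable_EFinP; exact: measurable_funM.
have mhp : measurable_fun [set: T] (fun x => h x `^ p)%R.
  exact: (measurableT_comp (measurable_powR p)).
have mkhp : measurable_fun [set: T] (fun x => (k x * h x `^ p)%:E).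
  by apply/measurable_EFinP; exact: measurable_funM.
set S := \int[mu]_x (k x * h x `^ p)%:E.
have S0 : 0 <= S by apply: integral_ge0 => x _; rewrite lee_fin mulr_ge0// powR_ge0.
have [Soo|Soo] := eqVneq S +oo.
  by rewrite Soo gt0_muley ?leey// lte_fin.
have Sfin : S \is a fin_num by rewrite ge0_fin_numE// ltey.
apply/lee_addgt0Pr => e e0.
(* s exceeds S by just enough to add e after multiplication by the constant. *)
pose s := (fine S + e / ((2 * M) `^ p / M))%R.
have s0 : (0 < s)%R by apply: ltr_wpDl; [exact: fine_ge0|exact: divr_gt0].
have Ss : S <= s%:E by rewrite -(fineK Sfin) lee_fin lerDl divr_ge0// ltW.
have -> : ((2 * M) `^ p / M)%:E * S + e%:E = ((2 * M) `^ p / M * s)%:E.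
  by rewrite -(fineK Sfin) -EFinM -EFinD mulrDr mulrCA mulfV ?gt_eqF// mulr1.
pose lam := ((s / M) `^ p^-1)%R.
have lam0 : (0 < lam)%R by rewrite powR_gt0// divr_gt0.
have lamp : (lam `^ p = s / M)%R.
  by rewrite -powRrM mulVf ?gt_eqF// powRr1// ltW// divr_gt0.
have lams : (lam `^ (1 - p) * s = lam * M)%R.
  rewrite powRD ?(gt_eqF lam0) ?implybT// powRr1 ?(ltW lam0)// powRN lamp.
  by rewrite invf_div -mulrA divfK// gt_eqF.
have J : \int[mu]_x (k x * h x)%:E <= (2 * M * lam)%:E.
  apply: (@le_trans _ _ (\int[mu]_x (lam%:E * (k x)%:E +
      (lam `^ (1 - p))%:E * (k x * h x `^ p)%:E))).
    apply: ge0_le_integral => //=.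
    - by move=> x _; rewrite lee_fin mulr_ge0.
    - apply: emeasurable_funD; apply: measurable_funeM => //.
      exact/measurable_EFinP.
    - move=> x _; rewrite -!EFinM -EFinD lee_fin.
      rewrite [X in (_ <= X + _)%R]mulrC [X in (_ <= _ + X)%R]mulrCA -mulrDr.
      by rewrite ler_wpM2l// le_threshold.
  rewrite ge0_integralD//=; last 4 first.
  - by move=> x _; rewrite mule_ge0// lee_fin// ltW.
  - by apply: measurable_funeM; exact/measurable_EFinP.
  - by move=> x _; rewrite mule_ge0// lee_fin ?mulr_ge0 ?powR_ge0.
  - exact: measurable_funeM.
  rewrite ge0_integralZl//=; first last.
  - by rewrite lee_fin ltW.
  - by move=> x _; rewrite lee_fin.
  - exact/measurable_EFinP.
  rewrite ge0_integralZl//=; first last.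
  - by rewrite lee_fin powR_ge0.
  - by move=> x _; rewrite lee_fin ?mulr_ge0 ?powR_ge0.
  apply: (@le_trans _ _ (lam%:E * M%:E + (lam `^ (1 - p))%:E * s%:E)).
    apply: leeD; apply: lee_wpmul2l; rewrite ?lee_fin ?powR_ge0 ?(ltW lam0)//.
  by rewrite -!EFinM lams -EFinD lee_fin; lra.
apply: (@le_trans _ _ ((2 * M * lam)%:E `^ p)).
  apply: gt0_ler_poweR => //.
  - exact: ltW.
  - by rewrite in_itv/= leey andbT; apply: integral_ge0 => x _;
      rewrite lee_fin mulr_ge0.
  - by rewrite in_itv/= leey andbT lee_fin !mulr_ge0// ltW.
rewrite poweR_EFin lee_fin powRM ?mulr_ge0 ?(ltW M0) ?(ltW lam0)// lamp.
by rewrite mulrA mulrAC.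
Qed.

Lemma schur_test (mu : {sigma_finite_measure set T -> \bar R})
    (k : T * T -> R) (h : T -> R) (M p : R) :
  (1 <= p)%R -> (0 < M)%R ->
  measurable_fun [set: T * T] k -> (forall x, 0 <= k x)%R ->
  (forall x, \int[mu]_w (k (x, w))%:E <= M%:E) ->
  (forall w, \int[mu]_x (k (x, w))%:E <= M%:E) ->
  measurable_fun [set: T] h -> (forall x, 0 <= h x)%R ->
  \int[mu]_x (\int[mu]_w (k (x, w) * h w)%:E) `^ p <=
    ((2 * M) `^ p)%:E * \int[mu]_w (h w `^ p)%:E.
Proof.
move=> p1 M0 mk k0 krow kcol mh h0.
have c0 : (0 <= (2 * M) `^ p / M)%R by rewrite divr_ge0 ?powR_ge0 ?ltW.
have msec x : measurable_fun [set: T] (fun w => k (x, w)).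
  exact: (measurableT_comp mk (measurable_pair1 x)).
have mhp : measurable_fun [set: T] (fun x => h x `^ p)%R.
  exact: (measurableT_comp (measurable_powR p)).
have mkh : measurable_fun [set: T * T] (fun xw => (k xw * h xw.2)%:E).
  apply/measurable_EFinP; apply: measurable_funM => //.
  exact: (measurableT_comp mh).
have mkhp : measurable_fun [set: T * T] (fun xw => (k xw * h xw.2 `^ p)%:E).
  apply/measurable_EFinP; apply: measurable_funM => //.
  exact: (measurableT_comp mhp).
have kh0 xw : 0 <= (k xw * h xw.2)%:E by rewrite lee_fin mulr_ge0.
have khp0 xw : 0 <= (k xw * h xw.2 `^ p)%:E by rewrite lee_fin mulr_ge0 ?powR_ge0.
have mJ := measurable_fun_fubini_tonelli_F (m2 := mu) _ mkh kh0.
have mS := measurable_fun_fubini_tonelli_F (m2 := mu) _ mkhp khp0.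
have mS' := measurable_fun_fubini_tonelli_G (m1 := mu) _ mkhp khp0.
apply: (@le_trans _ _ (\int[mu]_x (((2 * M) `^ p / M)%:E *
    \int[mu]_w (k (x, w) * h w `^ p)%:E))).
  apply: ge0_le_integral => //=.
  - by move=> x _; exact: poweR_ge0.
  - exact: (measurableT_comp (measurable_poweR p) mJ).
  - exact: (measurable_funeM _ mS).
  - by move=> x _; exact: jensen_powR.
rewrite (ge0_integralZl mu measurableT mS); last 2 first.
- by move=> x _; apply: integral_ge0 => w _; exact: (khp0 (x, w)).
- by rewrite lee_fin.
rewrite (fubini_tonelli (m1 := mu) (m2 := mu) _ mkhp khp0) /=.
apply: (@le_trans _ _ (((2 * M) `^ p / M)%:E *
    \int[mu]_w ((h w `^ p)%:E * M%:E))).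
  apply: lee_wpmul2l; first by rewrite lee_fin.
  apply: ge0_le_integral => //=.
  - by move=> w _; apply: integral_ge0 => x _; exact: (khp0 (x, w)).
  - under eq_fun do rewrite muleC.
    by apply: measurable_funeM; exact/measurable_EFinP.
  - move=> w _; under eq_integral do rewrite mulrC EFinM.
    rewrite ge0_integralZl//.
    + by apply: lee_wpmul2l; [rewrite lee_fin powR_ge0|exact: kcol].
    + apply/measurable_EFinP.
      exact: (measurableT_comp mk (measurable_pair2 w)).
    + by move=> x _; rewrite lee_fin.
    + by rewrite lee_fin powR_ge0.
rewrite ge0_integralZr//.
- by rewrite muleCA -EFinM divfK ?gt_eqF// muleC.
- exact/measurable_EFinP.
- by move=> x _; rewrite lee_fin powR_ge0.
- by rewrite lee_fin ltW.
Qed.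

End Schur.

(** * The integral of the product of the two power kernels *)

Section Kernel.
Context {R : realType} {K : nonarchLocalFieldType}.
Variables (v : K -> R) (q : nat).
Hypothesis hv : normalized_absolute_value v q.
Variable mu : {measure set K -> \bar R}.
Hypothesis hmu : normalized_haar_measure v mu.
Variable a : R.
Hypotheses (a0 : 0 < a) (a1 : a < 1).

Implicit Types x w y : K.

Let Q : R := q%:R.

Let Q_gt1 : 1 < Q. Proof. by rewrite ltr1n (q_gt1 hv). Qed.
Let Q_gt0 : 0 < Q. Proof. exact: lt_trans Q_gt1. Qed.

(** The integral of |y|^(alpha - 1) over the ball of radius r is this constant
    times r^alpha, and the integral of |y|^(- alpha - 1) over the outside of that
    ball is the same constant times r^(- alpha). *)
Definition ball_const : R := (1 - Q^-1) / (1 - Q `^ (- a)).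
Let B := ball_const.

Let QVa_gt0 : 0 < Q `^ (- a). Proof. exact: powR_gt0. Qed.
Let QVa_lt1 : Q `^ (- a) < 1.
Proof. by rewrite /powR gt_eqF// expR_lt1 pmulr_llt0 ?ln_gt0// oppr_lt0. Qed.
Let QV_lt1 : Q^-1 < 1. Proof. by rewrite invf_lt1. Qed.

Lemma ball_const_gt0 : 0 < B.
Proof. by rewrite divr_gt0// subr_gt0. Qed.

Lemma integral_riesz_ball x r : is_value v r ->
  (\int[mu]_(y in [set y | (v (y - x) <= r)%R]) (v (y - x) `^ (a - 1))%:E =
   (B * r `^ a)%:E)%E.
Proof.
move=> vr; rewrite (integral_closed_ball hv hmu) ?subrK//.
by rewrite /B /ball_const mulrAC.
Qed.

Lemma integral_fracdiff_outside x r : is_value v r ->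
  (\int[mu]_(y in [set y | (r <= v (y - x))%R]) (v (y - x) `^ (- (a + 1)))%:E =
   (B * r `^ (- a))%:E)%E.
Proof.
move=> vr; have tE : - (a + 1) + 1 = - a by ring.
rewrite (integral_outside_ball hv hmu) ?tE ?oppr_lt0//.
by rewrite /B /ball_const mulrAC.
Qed.

Lemma integral_inv2_outside x r : is_value v r ->
  (\int[mu]_(y in [set y | (r <= v (y - x))%R]) (v (y - x) `^ (- 2))%:E =
   (r^-1)%:E)%E.
Proof.
move=> vr; have tE : - 2 + 1 = - 1 :> R by ring.
rewrite (integral_outside_ball hv hmu) ?tE ?oppr_lt0//.
rewrite !powR_inv1 ?ltW// ?(value_gt0 hv)//.
by rewrite mulrC mulKf// subr_eq0 gt_eqF.
Qed.

Lemma measurable_outside x r : measurable [set y | r <= v (y - x)].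
Proof.
rewrite (_ : [set y | r <= v (y - x)] = ~` [set y | v (y - x) < r]).
  by apply: measurableC; exact: (measurable_open_ball hv).
by apply/seteqP; split=> y /=; rewrite leNgt => /negP.
Qed.

Lemma measurable_kernel_product x w s t :
  measurable_fun [set: K] (fun y => (v (y - x) `^ s * v (y - w) `^ t)%:E).
Proof.
by apply/measurable_EFinP; apply: measurable_funM; exact: (measurable_absv_powR hv).
Qed.

Let mf (x w : K) (D : set K) : measurable_fun D
  (fun y => (v (y - x) `^ (- (a + 1)) * v (y - w) `^ (a - 1))%:E).
Proof. by apply: measurable_funTS; exact: measurable_kernel_product. Qed.

(** On the domain of integration w is closer to x than y is, so that the two
    distances to y coincide. *)
Lemma outside_kernel_near x w eps : is_value v eps -> v (w - x) < eps ->
  (\int[mu]_(y in [set y | (eps <= v (y - x))%R])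
     (v (y - x) `^ (- (a + 1)) * v (y - w) `^ (a - 1))%:E = (eps^-1)%:E)%E.
Proof.
move=> veps wx; rewrite -(integral_inv2_outside x veps).
apply: eq_integral => y; rewrite inE/= => yx.
have yx0 : 0 < v (y - x) by exact: lt_le_trans (value_gt0 hv veps) yx.
have -> : v (y - w) = v (y - x).
  rewrite (absv_distC hv) (absv_distC hv y); apply: (absv_isosceles hv).
  by rewrite [ltRHS](absv_distC hv); exact: lt_le_trans yx.
rewrite -powRD ?(gt_eqF yx0) ?implybT//; congr (_ `^ _)%:E; ring.
Qed.

(** The sphere around x through w, together with the open ball
    around x, is the closed ball around w; on that open ball the distance to w is
    constant. *)
Lemma integral_riesz_sphere x w : x != w ->
  (\int[mu]_(y in [set y | (v (y - x) = v (w - x))%R]) (v (y - w) `^ (a - 1))%:E =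
   (v (w - x) `^ a * (B - Q^-1))%:E)%E.
Proof.
move=> xw; set r := v (w - x).
have vr : is_value v r by apply: is_value_dist; rewrite eq_sym.
have r0 := value_gt0 hv vr.
have := integral_riesz_ball w vr.
have -> : [set y | v (y - w) <= r] = [set y | v (y - x) = r] `|` [set y | v (y - x) < r].
  apply/seteqP; split=> y /=.
    move=> yw; apply/predU1P; rewrite -le_eqVlt.
    by apply: le_trans (absv_ultra hv w _ _) _; rewrite ge_max yw lexx.
  move/predU1P; rewrite -le_eqVlt => yx.
  by apply: le_trans (absv_ultra hv x _ _) _;
    rewrite ge_max yx (absv_distC hv) lexx.
have mv D : measurable_fun D (fun y => (v (y - w) `^ (a - 1))%:E).
  by apply: measurable_funTS; apply/measurable_EFinP; exact: (measurable_absv_powR hv).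
rewrite ge0_integral_setU//; last 4 first.
- exact: (measurable_sphere hv).
- exact: (measurable_open_ball hv).
- by move=> y _; rewrite lee_fin powR_ge0.
- by apply/disj_setPS => y /= [->]; rewrite ltxx.
rewrite [X in (_ + X)%E](_ : _ = (r `^ a / Q)%:E); last first.
  rewrite (eq_integral (cst (r `^ (a - 1))%:E)); last first.
    move=> y; rewrite inE/= => yr; congr ((_ `^ _)%:E).
    rewrite (absv_isosceles hv (y := x)) ?(absv_distC hv x)//.
  rewrite integral_cst; last exact: (measurable_open_ball hv).
  rewrite (haar_open_ball hv hmu)// -EFinM mulrA; congr (_ / _)%:E.
  by rewrite mulrC mulr_powRB1// ltW.
move=> h; have -> : (r `^ a * (B - Q^-1))%:E = ((B * r `^ a)%:E - (r `^ a / Q)%:E)%E.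
  by rewrite -EFinB; congr EFin; ring.
by rewrite -h addeK.
Qed.

(** Equivalently, v (y - w) may be replaced by v (w - x) without changing
    the integral.  This is clear where v (y - x) < v (w - x).  On the rest both
    sides can be evaluated, the left one by splitting off the sphere that contains
    w, and the values agree. *)
Lemma outside_kernel_far x w eps : is_value v eps -> eps <= v (w - x) ->
  (\int[mu]_(y in [set y | (eps <= v (y - x))%R])
     (v (y - x) `^ (- (a + 1)) * v (y - w) `^ (a - 1))%:E =
   (B * eps `^ (- a) * v (w - x) `^ (a - 1))%:E)%E.
Proof.
move=> veps; set r := v (w - x) => er.
have xw : x != w.
  apply: contraTneq er => xw.
  by rewrite /r xw subrr (absv0 hv) -ltNge (value_gt0 hv).
have vr : is_value v r by apply: is_value_dist; rewrite eq_sym.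
have r0 := value_gt0 hv vr.
have mD1 : measurable [set y | eps <= v (y - x) < r].
  rewrite (_ : [set y | eps <= v (y - x) < r] =
      [set y | eps <= v (y - x)] `&` [set y | v (y - x) < r]).
    by apply: measurableI; [exact: measurable_outside|exact: (measurable_open_ball hv)].
  by apply/seteqP; split=> y /= => [/andP[]|[-> ->]].
have D1D' : [set y | eps <= v (y - x)] =
    [set y | eps <= v (y - x) < r] `|` [set y | r <= v (y - x)].
  apply/seteqP; split=> y /=.
    by move=> ->; have [] := ltP (v (y - x)) r; [left|right].
  by case=> [/andP[]//|]; exact: le_trans.
have D2D3 : [set y | r <= v (y - x)] =
    [set y | v (y - x) = r] `|` [set y | r * Q <= v (y - x)].
  apply/seteqP; split=> y /=.
    rewrite le_eqVlt => /predU1P[<-|]; first by left.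
    case: vr => c c0 vc ry; right; rewrite -ler_pdivlMr//.
    by rewrite -vc; apply: (absv_discrete hv); rewrite vc.
  case=> [->//|]; apply: le_trans; rewrite ler_peMr// ltW//.
have dD1D' : [disjoint [set y | eps <= v (y - x) < r] & [set y | r <= v (y - x)]].
  by apply/disj_setPS => y /= [/andP[_ ]]; rewrite ltNge => /negP.
have dD2D3 : [disjoint [set y | v (y - x) = r] & [set y | r * Q <= v (y - x)]].
  apply/disj_setPS => y /= [->]; rewrite leNgt => /negP; apply.
  by rewrite ltr_pMr.
have mf' D := @mf x w D.
have mg D : measurable_fun D
   (fun y => (r `^ (a - 1))%:E * (v (y - x) `^ (- (a + 1)))%:E)%E.
  apply: measurable_funTS; apply: measurable_funeM.
  by apply/measurable_EFinP; exact: (measurable_absv_powR hv).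
have g0 y : (0 <= (r `^ (a - 1))%:E * (v (y - x) `^ (- (a + 1)))%:E)%E.
  by rewrite mule_ge0// lee_fin powR_ge0.
have int_g r' : is_value v r' ->
    (\int[mu]_(y in [set y | (r' <= v (y - x))%R])
     ((r `^ (a - 1))%:E * (v (y - x) `^ (- (a + 1)))%:E) =
     (r `^ (a - 1) * (B * r' `^ (- a)))%:E)%E.
  move=> vr'; rewrite ge0_integralZl//.
  - by rewrite integral_fracdiff_outside// -EFinM.
  - exact: measurable_outside.
  - apply: measurable_funTS; apply/measurable_EFinP.
    exact: (measurable_absv_powR hv).
  - by move=> y _; rewrite lee_fin powR_ge0.
  - by rewrite lee_fin powR_ge0.
have -> : (B * eps `^ (- a) * r `^ (a - 1))%:E =
    (r `^ (a - 1) * (B * eps `^ (- a)))%:E by congr EFin; ring.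
have f0 y : (0 <= (v (y - x) `^ (- (a + 1)) * v (y - w) `^ (a - 1))%:E)%E.
  by rewrite lee_fin mulr_ge0 ?powR_ge0.
have mD' := measurable_outside x r.
rewrite -(int_g eps veps) D1D'.
rewrite (ge0_integral_setU mu mD1 mD' (mf' _) (fun y _ => f0 y) dD1D').
rewrite (ge0_integral_setU mu mD1 mD' (mg _) (fun y _ => g0 y) dD1D').
apply: (f_equal2 (fun s t => s + t)%E).
  apply: eq_integral => y; rewrite inE/= => /andP[ey yr].
  rewrite -EFinM mulrC; congr (_ `^ _ * _)%:E.
  by rewrite (absv_isosceles hv (y := x)) ?(absv_distC hv x).
rewrite int_g// D2D3 ge0_integral_setU//; last 2 first.
- exact: (measurable_sphere hv).
- exact: measurable_outside.
rewrite outside_kernel_near//; last 2 first.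
- exact: (is_value_mulq hv).
- by rewrite ltr_pMr.
rewrite (eq_integral (fun y => (r `^ (- (a + 1)))%:E * (v (y - w) `^ (a - 1))%:E)%E);
  last first.
  by move=> y; rewrite inE/= => ->; rewrite EFinM.
rewrite ge0_integralZl//; last 4 first.
- exact: (measurable_sphere hv).
- apply: measurable_funTS; apply/measurable_EFinP.
  exact: (measurable_absv_powR hv).
- by move=> y _; rewrite lee_fin powR_ge0.
- by rewrite lee_fin powR_ge0.
rewrite integral_riesz_sphere// -EFinM -EFinD; congr EFin.
(* With the powers of r expressed by r^a and r, both sides equal B / r. *)
have -> : r `^ (a - 1) = r `^ a / r by rewrite -powR_inv1 ?ltW// -powRD// (gt_eqF r0)
  implybT.
have -> : r `^ (- (a + 1)) = (r `^ a)^-1 / r.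
  by rewrite -powRN -powR_inv1 ?ltW// -powRD ?(gt_eqF r0) ?implybT// opprD.
rewrite powRN invfM.
have ra0 : r `^ a != 0 by rewrite gt_eqF// powR_gt0.
have r0' : r != 0 by rewrite gt_eqF.
have Q0' : Q != 0 by rewrite gt_eqF.
by rewrite -/r; field; rewrite ra0 r0' Q0'.
Qed.

End Kernel.

(** * The composed operator as an integral operator *)

Section RealIntegral.
Context {R : realType} {d : measure_display} {T : measurableType d}.
Variable mu : {measure set T -> \bar R}.

Lemma ae_eq_integrable (f g : T -> \bar R) :
  mu.-integrable [set: T] f -> measurable_fun [set: T] g ->
  ae_eq mu [set: T] f g -> mu.-integrable [set: T] g.
Proof.
move=> intf mg fg; have mf := measurable_int mu intf.
move/integrableP : intf => [_ foo]; apply/integrableP; split=> //.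
suff <- : (\int[mu]_x `|f x| = \int[mu]_x `|g x|)%E by [].
by apply: ge0_ae_eq_integral => //; [exact: measurableT_comp|
  exact: measurableT_comp|exact: ae_eq_abse].
Qed.

Lemma integrable_scale (c : R) (f : T -> R) :
  mu.-integrable [set: T] (EFin \o f) ->
  mu.-integrable [set: T] (EFin \o (fun x => c * f x)).
Proof.
move=> intf; rewrite (_ : _ \o _ = (fun x => c%:E * (EFin \o f) x)%E).
  exact: integrableZl.
by apply/funext => x /=; rewrite EFinM.
Qed.

Lemma integrable_diff (f g : T -> R) :
  mu.-integrable [set: T] (EFin \o f) -> mu.-integrable [set: T] (EFin \o g) ->
  mu.-integrable [set: T] (EFin \o (fun x => f x - g x)).
Proof.
move=> intf intg; rewrite (_ : _ \o _ = ((EFin \o f) \- (EFin \o g))%E).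
  exact: integrableB.
by apply/funext => x /=; rewrite EFinB.
Qed.

End RealIntegral.

(** The positive and negative parts are treated separately, so
    that nothing has to be integrable. *)
Lemma measurable_Rintegral_section {R : realType} {d : measure_display}
    {T : measurableType d} (mu : {sigma_finite_measure set T -> \bar R})
    (F : T * T -> R) : measurable_fun [set: T * T] F ->
  measurable_fun [set: T] (fun x => Rintegral mu [set: T] (fun y => F (x, y))).
Proof.
move=> mF; have mF' : measurable_fun [set: T * T] (EFin \o F) by exact/measurable_EFinP.
rewrite (_ : (fun _ => _) = fine \o (fun x => \int[mu]_y (EFin \o F)^\+%E (x, y) -
    \int[mu]_y (EFin \o F)^\-%E (x, y))%E).
  apply: measurableT_comp => //; apply: emeasurable_funB.
    apply: (measurable_fun_fubini_tonelli_F (m2 := mu)) => //.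
    exact: measurable_funepos.
  apply: (measurable_fun_fubini_tonelli_F (m2 := mu)) => //.
  exact: measurable_funeneg.
apply/funext => x; rewrite /Rintegral integralE /=.
by congr (fine (_ - _)%E); apply: eq_integral => w _; rewrite ?funeposE ?funenegE.
Qed.

Section Identity.
Context {R : realType} {K : nonarchLocalFieldType}.
Variables (v : K -> R) (q : nat).
Hypothesis hv : normalized_absolute_value v q.
Variable mu : {sigma_finite_measure set K -> \bar R}.
Hypothesis hmu : normalized_haar_measure v mu.
Variable a : R.
Hypotheses (a0 : 0 < a) (a1 : a < 1).

Implicit Types x w y : K.

Let Q : R := q%:R.
Let B : R := ball_const q a.

Let B_gt0 : 0 < B. Proof. exact: (ball_const_gt0 hv). Qed.

(** The cut-off at eps is part of the kernel, so that all integrals are taken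
    over the whole field. *)
Definition fracdiff_kernel (eps t : R) : R :=
  if eps <= t then t `^ (- (a + 1)) else 0.

(** The value of the integral in [outside_kernelE]. *)
Definition outside_kernel (eps t : R) : R :=
  if t < eps then eps^-1 else B * eps `^ (- a) * t `^ (a - 1).

(** The kernel of the composition of the truncated derivative with the Riesz
    potential; the subtracted term comes from the term u x of the difference
    quotient. *)
Definition approx_kernel (eps t : R) : R :=
  fracdiff_const q a * riesz_const q a *
  (outside_kernel eps t - B * eps `^ (- a) * t `^ (a - 1)).

Definition Rriesz (f : K -> R) x : R :=
  riesz_const q a * Rintegral mu [set: K] (fun y => v (x - y) `^ (a - 1) * f y).

Definition Rfracdiff (eps : R) (u : K -> R) x : R :=
  fracdiff_const q a * Rintegral mu [set y | eps <= v (y - x)]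
    (fun y => (u y - u x) / v (y - x) `^ (a + 1)).

Lemma fracdiff_kernel_ge0 eps t : 0 <= fracdiff_kernel eps t.
Proof. by rewrite /fracdiff_kernel; case: ifP => // _; exact: powR_ge0. Qed.

Lemma outside_kernel_ge0 eps t : 0 < eps -> 0 <= outside_kernel eps t.
Proof.
move=> e0; rewrite /outside_kernel; case: ifP => _; first by rewrite invr_ge0 ltW.
by rewrite mulr_ge0 ?powR_ge0// mulr_ge0 ?powR_ge0// ltW.
Qed.

Lemma measurable_fracdiff_kernel eps : measurable_fun [set: R] (fracdiff_kernel eps).
Proof.
apply: measurable_fun_ifT => //; first exact: measurable_fun_ler.
Qed.

Lemma measurable_outside_kernel eps : measurable_fun [set: R] (outside_kernel eps).
Proof.
apply: measurable_fun_ifT => //; first exact: measurable_fun_ltr.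
by apply: measurable_funM => //; exact: measurable_powR.
Qed.

Lemma measurable_approx_kernel eps : measurable_fun [set: R] (approx_kernel eps).
Proof.
apply: measurable_funM => //; apply: measurable_funB.
  exact: measurable_outside_kernel.
by apply: measurable_funM => //; exact: measurable_powR.
Qed.

Lemma outside_kernelE x w eps : is_value v eps ->
  (\int[mu]_y (fracdiff_kernel eps (v (y - x)) * v (y - w) `^ (a - 1))%:E =
   (outside_kernel eps (v (w - x)))%:E)%E.
Proof.
move=> veps.
have -> : (\int[mu]_y (fracdiff_kernel eps (v (y - x)) * v (y - w) `^ (a - 1))%:E =
    \int[mu]_(y in [set y | (eps <= v (y - x))%R])
     (v (y - x) `^ (- (a + 1)) * v (y - w) `^ (a - 1))%:E)%E.
  rewrite [RHS]integral_mkcond; apply: eq_integral => y _.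
  rewrite patchE /fracdiff_kernel; have [eyx|eyx] := boolP (eps <= v (y - x)).
    by rewrite mem_set.
  by rewrite memNset ?mul0r//; exact/negP.
rewrite /outside_kernel; case: ifPn => [wx|].
  exact: (outside_kernel_near hv hmu).
by rewrite -leNgt => wx; exact: (outside_kernel_far hv hmu).
Qed.

Lemma outside_kernel_le eps t : 0 < eps -> 0 < t ->
  outside_kernel eps t <= (1 + B) * eps `^ (- a) * t `^ (a - 1).
Proof.
move=> e0 t0; rewrite /outside_kernel; case: ifPn => [te|_]; last first.
  by rewrite ler_wpM2r ?powR_ge0// ler_wpM2r ?powR_ge0// lerDr.
apply: (@le_trans _ _ (eps `^ (- a) * t `^ (a - 1))); last first.
  by rewrite ler_wpM2r ?powR_ge0// ler_peMl ?powR_ge0// lerDl ltW.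
have -> : eps^-1 = eps `^ (- a) * eps `^ (a - 1).
  rewrite -powRD ?(gt_eqF e0) ?implybT// -(powR_inv1 (ltW e0)).
  by congr (_ `^ _); ring.
rewrite ler_wpM2l ?powR_ge0//.
rewrite -opprB !powRN lef_pV2 ?posrE ?powR_gt0//.
by apply: ge0_ler_powR; rewrite ?nnegrE ?subr_ge0 ?ltW.
Qed.

Let riesz_measurable (f : K -> R) x : measurable_fun [set: K] f ->
  measurable_fun [set: K] (fun w => v (x - w) `^ (a - 1) * f w).
Proof.
move=> mf; apply: measurable_funM => //.
rewrite (_ : (fun _ => _) = (fun w => v (w - x) `^ (a - 1))).
  exact: (measurable_absv_powR hv).
by apply/funext => w; rewrite (absv_distC hv).
Qed.

Lemma riesz_integrable (f : K -> R) x : measurable_fun [set: K] f ->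
  (\int[mu]_w (v (x - w) `^ (a - 1) * `|f w|)%:E < +oo)%E ->
  mu.-integrable [set: K] (EFin \o (fun w => v (x - w) `^ (a - 1) * f w)).
Proof.
move=> mf fin; apply/integrableP; split.
  by apply/measurable_EFinP; exact: (riesz_measurable x mf).
apply: le_lt_trans fin; apply: ge0_le_integral => //=.
- apply/measurable_EFinP; apply: measurableT_comp => //.
  exact: (riesz_measurable x mf).
- by apply/measurable_EFinP; apply: riesz_measurable; exact: measurableT_comp.
- by move=> w _; rewrite lee_fin normrM (ger0_norm (powR_ge0 _ _)).
Qed.

(** Points are null sets; the bound [outside_kernel_le] fails on the diagonal, where
    a negative power of 0 is 0. *)
Lemma ae_neq x : \forall w \ae mu, x != w.
Proof.
exists [set x]; split; first exact: (measurable_center hv).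
  exact: (haar_center hv hmu).
by move=> w /= /negP/negPn/eqP.
Qed.

Lemma fracdiff_kernel_integral eps x : is_value v eps ->
  (\int[mu]_y (fracdiff_kernel eps (v (y - x)))%:E = (B * eps `^ (- a))%:E)%E.
Proof.
move=> veps; rewrite -(integral_fracdiff_outside hv hmu a0 x veps).
rewrite [RHS]integral_mkcond; apply: eq_integral => y _.
rewrite patchE /fracdiff_kernel; have [eyx|eyx] := boolP (eps <= v (y - x)).
  by rewrite mem_set.
by rewrite memNset//; exact/negP.
Qed.

Lemma Rfracdiff_mkcond eps u x : Rfracdiff eps u x =
  fracdiff_const q a * Rintegral mu [set: K]
    (fun y => fracdiff_kernel eps (v (y - x)) * (u y - u x)).
Proof.
rewrite /Rfracdiff Rintegral_mkcond; congr (_ * Rintegral _ _ _).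
apply/funext => y.
rewrite patchE /fracdiff_kernel; have [eyx|eyx] := boolP (eps <= v (y - x)).
  by rewrite mem_set// powRN mulrC.
by rewrite memNset ?mul0r//; exact/negP.
Qed.

(** Fubini's theorem for the function F below.  Its absolute integral is
    that of outside_kernel times |f|, which is finite at x because outside_kernel
    is dominated by a multiple of the Riesz kernel ([outside_kernel_le]). *)
Lemma Rfracdiff_Rriesz (f : K -> R) eps x : is_value v eps ->
  measurable_fun [set: K] f ->
  (\int[mu]_w (v (x - w) `^ (a - 1) * `|f w|)%:E < +oo)%E ->
  mu.-integrable [set: K] (EFin \o (fun w => approx_kernel eps (v (w - x)) * f w)) /\
  Rfracdiff eps (Rriesz f) x =
    Rintegral mu [set: K] (fun w => approx_kernel eps (v (w - x)) * f w).
Proof.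
move=> veps mf fin.
have e0 := value_gt0 hv veps.
pose kap y := fracdiff_kernel eps (v (y - x)).
pose G w := outside_kernel eps (v (w - x)).
have mkap : measurable_fun [set: K] kap.
  exact: (measurableT_comp (measurable_fracdiff_kernel eps) (measurable_absvBr hv x)).
have mG : measurable_fun [set: K] G.
  exact: (measurableT_comp (measurable_outside_kernel eps) (measurable_absvBr hv x)).
pose F (yw : K * K) := (kap yw.1 * v (yw.1 - yw.2) `^ (a - 1)) * f yw.2.
have mF : measurable_fun [set: K * K] (EFin \o F).
  apply/measurable_EFinP; apply: measurable_funM; last exact: (measurableT_comp mf).
  apply: measurable_funM; first exact: (measurableT_comp mkap).
  exact: (measurableT_comp (measurable_powR (a - 1)) (measurable_absv_dist hv)).
have intrf := riesz_integrable mf fin.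
have C0 : 0 <= (1 + B) * eps `^ (- a).
  by rewrite mulr_ge0 ?powR_ge0// addr_ge0// ltW.
have intGf : mu.-integrable [set: K] (EFin \o (fun w => G w * f w)).
  apply/integrableP; split; first by apply/measurable_EFinP; exact: measurable_funM.
  apply: (@le_lt_trans _ _ (\int[mu]_w (((1 + B) * eps `^ (- a))%:E *
     (v (x - w) `^ (a - 1) * `|f w|)%:E))%E); last first.
    rewrite ge0_integralZl//.
    - by apply: lte_mul_pinfty => //; rewrite lee_fin.
    - by apply/measurable_EFinP; apply: riesz_measurable; exact: measurableT_comp.
    - by move=> w _; rewrite lee_fin mulr_ge0 ?powR_ge0.
  apply: ae_ge0_le_integral => //=.
  - by apply/measurable_EFinP; apply: measurableT_comp => //; exact: measurable_funM.
  - move=> w _; rewrite -EFinM lee_fin; apply: mulr_ge0 => //.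
    by rewrite mulr_ge0 ?powR_ge0.
  - apply: measurable_funeM; apply/measurable_EFinP; apply: riesz_measurable.
    exact: measurableT_comp.
  - apply: filterS (ae_neq x) => w xw _.
    rewrite -EFinM lee_fin normrM mulrA ler_wpM2r//.
    rewrite ger0_norm ?outside_kernel_ge0// (absv_distC hv x).
    apply: outside_kernel_le => //.
    by rewrite (absv_gt0 hv) subr_eq0 eq_sym.
have inner w : (\int[mu]_y (F (y, w))%:E = (G w * f w)%:E)%E.
  under eq_integral do rewrite /F /= mulrC EFinM.
  rewrite integralZl//.
    by rewrite outside_kernelE// -EFinM mulrC.
  apply/integrableP; split.
    apply/measurable_EFinP; apply: measurable_funM => //.
    exact: (measurable_absv_powR hv).
  under eq_integral do
    rewrite gee0_abs ?lee_fin ?mulr_ge0 ?fracdiff_kernel_ge0 ?powR_ge0//.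
  by rewrite outside_kernelE// ltry.
have inner_abs w : (\int[mu]_y `|(F (y, w))%:E| = `|(G w * f w)%:E|)%E.
  under eq_integral do rewrite /F /= normrM mulrC EFinM.
  rewrite ge0_integralZl//.
  - under eq_integral do
      rewrite ger0_norm ?mulr_ge0 ?fracdiff_kernel_ge0 ?powR_ge0//.
    rewrite outside_kernelE// -EFinM mulrC /= normrM; congr (_ * _)%:E.
    by rewrite ger0_norm// outside_kernel_ge0.
  - apply/measurable_EFinP; apply: measurableT_comp => //; apply: measurable_funM => //.
    exact: (measurable_absv_powR hv).
have intF : (mu \x mu)%E.-integrable [set: K * K] (EFin \o F).
  apply/(integrable21ltyP mu mu mF).
  move/integrableP : intGf => [mGf]; apply: le_lt_trans.
  apply: ge0_le_integral => //=.
  - by move=> w _; exact: integral_ge0.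
  - apply: (measurable_fun_fubini_tonelli_G (m1 := mu) (fun z => `|(F z)%:E|)%E) => //.
    exact: measurableT_comp.
  - by apply/measurable_EFinP; apply: measurableT_comp => //; exact: measurable_funM.
  - by move=> w _; rewrite inner_abs.
pose g y := Rintegral mu [set: K] (fun w => v (y - w) `^ (a - 1) * f w).
(* Off the support of kap both sides vanish, even where g is the integral of a
   function that is not integrable. *)
have aeg : \forall y \ae mu, (\int[mu]_w (F (y, w))%:E = (kap y * g y)%:E)%E.
  apply: filterS (ae_integrable1 intF) => y intFy.
  have [k0|k0] := eqVneq (kap y) 0.
    rewrite k0 mul0r; apply: integral0_eq => w _.
    by rewrite /F /= k0 !mul0r.
  have intvf : mu.-integrable [set: K] (EFin \o (fun w => v (y - w) `^ (a - 1) * f w)).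
    rewrite (_ : (fun _ => _) = (fun w => (kap y)^-1 * F (y, w))).
      exact: integrable_scale.
    by apply/funext => w; rewrite /F /= -mulrA mulKf.
  rewrite /g -RintegralZl// -[LHS]fineK.
    by rewrite /Rintegral; congr ((fine _)%:E); apply: eq_integral => w _;
      rewrite /F /= mulrA.
  by apply: integrable_fin_num => //.
have mg : measurable_fun [set: K] (fun y => kap y * g y).
  apply: measurable_funM => //.
  pose F' (yw : K * K) := v (yw.1 - yw.2) `^ (a - 1) * f yw.2.
  apply: (@measurable_Rintegral_section _ _ _ mu F').
  apply: measurable_funM; last exact: (measurableT_comp mf).
  exact: (measurableT_comp (measurable_powR (a - 1)) (measurable_absv_dist hv)).
have [intkg intkgE] : mu.-integrable [set: K] (EFin \o (fun y => kap y * g y)) /\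
    Rintegral mu [set: K] (fun y => kap y * g y) =
    Rintegral mu [set: K] (fun w => G w * f w).
  have intFF := integrable_fubini_F intF.
  have aeE : ae_eq mu [set: K] (fubini_F mu (EFin \o F)) (EFin \o (fun y => kap y * g y)).
    by apply: filterS aeg => y h _; exact: h.
  have mkg : measurable_fun [set: K] (EFin \o (fun y => kap y * g y)).
    exact/measurable_EFinP.
  split; first exact: ae_eq_integrable intFF mkg aeE.
  transitivity (fine (\int[mu]_y fubini_F mu (EFin \o F) y)).
    congr fine; apply/esym; apply: ae_eq_integral => //.
    exact: measurable_int intFF.
  congr fine; have := Fubini intF; rewrite /fubini_F => ->.
  by apply: eq_integral => w _; exact: inner.
have intkap : mu.-integrable [set: K] (EFin \o kap).
  apply/integrableP; split; first exact/measurable_EFinP.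
  under eq_integral do rewrite gee0_abs ?lee_fin ?fracdiff_kernel_ge0//.
  by rewrite fracdiff_kernel_integral// ltry.
have kapE : Rintegral mu [set: K] kap = B * eps `^ (- a).
  by rewrite /Rintegral fracdiff_kernel_integral.
have HE : (fun w => approx_kernel eps (v (w - x)) * f w) =
    (fun w => fracdiff_const q a * riesz_const q a *
      (G w * f w - B * eps `^ (- a) * (v (x - w) `^ (a - 1) * f w))).
  by apply/funext => w; rewrite /approx_kernel /G (absv_distC hv x); ring.
have int2 : mu.-integrable [set: K] (EFin \o
    (fun w => G w * f w - B * eps `^ (- a) * (v (x - w) `^ (a - 1) * f w))).
  by apply: integrable_diff => //; exact: integrable_scale.
split; first by rewrite HE; exact: integrable_scale.
rewrite HE RintegralZl// RintegralB//; last exact: integrable_scale.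
rewrite RintegralZl// -intkgE Rfracdiff_mkcond.
have -> : (fun y => fracdiff_kernel eps (v (y - x)) * (Rriesz f y - Rriesz f x)) =
    (fun y => riesz_const q a * (kap y * g y - g x * kap y)).
  by apply/funext => y; rewrite /kap /Rriesz /g; ring.
rewrite RintegralZl//; last first.
  by apply: integrable_diff => //; exact: integrable_scale.
rewrite RintegralB//; last exact: integrable_scale.
by rewrite RintegralZl// kapE /g; ring.
Qed.

End Identity.

(** * Almost everywhere existence of the Riesz potential *)

Section Existence.
Context {R : realType} {K : nonarchLocalFieldType}.
Variables (v : K -> R) (q : nat).
Hypothesis hv : normalized_absolute_value v q.
Variable mu : {sigma_finite_measure set K -> \bar R}.
Hypothesis hmu : normalized_haar_measure v mu.
Variables a p : R.
Hypotheses (a0 : 0 < a) (a1 : a < 1) (p1 : 1 <= p) (pa : p < 1 / a).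

Implicit Types x w y : K.

Let p0 : 0 < p. Proof. exact: lt_le_trans p1. Qed.

(** The exponent p' = 1 + r would be conjugate to p for r = 1 / (p - 1); for
    p = 1 every large r will do.  The last inequality makes |y|^((alpha - 1) (1 + r))
    integrable at infinity, and this is where p < 1 / alpha enters. *)
Lemma tail_exponent : exists r, [/\ 0 <= r, r * (p - 1) <= 1 & (a - 1) * (1 + r) + 1 < 0].
Proof.
have ap : a * p < 1 by rewrite mulrC -ltr_pdivlMr.
have [->|pneq1] := eqVneq p 1.
  exists (a / (1 - a) + 1); split.
  - by rewrite addr_ge0 ?divr_ge0 ?subr_ge0 ?(ltW a0) ?(ltW a1).
  - by rewrite subrr mulr0.
  - rewrite (_ : _ + 1 = a - 1); first by rewrite subr_lt0.
    by field; rewrite subr_eq0 gt_eqF.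
have p1' : 0 < p - 1 by rewrite subr_gt0 lt_def pneq1.
exists (p - 1)^-1; split.
- by rewrite invr_ge0 ltW.
- by rewrite mulVf// gt_eqF.
- rewrite (_ : _ + 1 = (a * p - 1) / (p - 1)); last by field; rewrite gt_eqF.
  by rewrite pmulr_llt0 ?invr_gt0// subr_lt0.
Qed.

(** Young's inequality without constants, for A <= 1: compare t with A^r. *)
Lemma tail_young r A t : r * (p - 1) <= 1 -> 0 < A <= 1 -> 0 <= t ->
  A * t <= t `^ p + A `^ (1 + r).
Proof.
move=> rp /andP[A0 A1] t0; have [tA|At] := leP t (A `^ r).
  apply: (@le_trans _ _ (A `^ (1 + r))); last by rewrite lerDr powR_ge0.
  by rewrite powRD ?(gt_eqF A0) ?implybT// powRr1 ?(ltW A0)// ler_wpM2l// ltW.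
have t0' : 0 < t by apply: le_lt_trans At; exact: powR_ge0.
apply: (@le_trans _ _ (t `^ p)); last by rewrite lerDl powR_ge0.
rewrite -mulr_powRB1// mulrC ler_wpM2l//.
apply: (@le_trans _ _ ((A `^ r) `^ (p - 1))).
  by rewrite -powRrM -[leLHS](powRr1 (ltW A0)); apply: ger_powR => //; rewrite A0.
by apply: ge0_ler_powR; rewrite ?nnegrE ?subr_ge0 ?powR_ge0// ltW.
Qed.

Lemma le1D_powR t : 0 <= t -> t <= 1 + t `^ p.
Proof.
move=> t0; have [t1|t1] := leP t 1; first by rewrite (le_trans t1)// lerDl powR_ge0.
by apply: le_trans (le1r_powR (ltW t1) p1) _; rewrite lerDr.
Qed.

Let k1 (t : R) := if t < 1 then t `^ (a - 1) else 0.
Let k2 (r t : R) := if 1 <= t then t `^ ((a - 1) * (1 + r)) else 0.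

Let k1_ge0 t : 0 <= k1 t.
Proof. by rewrite /k1; case: ifP => // _; exact: powR_ge0. Qed.

Let k2_ge0 r t : 0 <= k2 r t.
Proof. by rewrite /k2; case: ifP => // _; exact: powR_ge0. Qed.

Let mk1 : measurable_fun [set: R] k1.
Proof.
apply: measurable_fun_ifT => //; first exact: measurable_fun_ltr.
Qed.

Let mk2 r : measurable_fun [set: R] (k2 r).
Proof.
apply: measurable_fun_ifT => //; first exact: measurable_fun_ler.
Qed.

Let riesz_le r t h : r * (p - 1) <= 1 -> 0 <= t -> 0 <= h ->
  t `^ (a - 1) * h <= k1 t + k1 t * h `^ p + k2 r t + h `^ p.
Proof.
move=> rp t0 h0; have [t1|t1] := ltP t 1.
  rewrite /k1 /k2 t1 [1 <= t]leNgt t1/= addr0 -{2}[t `^ _]mulr1 -mulrDr.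
  apply: (@le_trans _ _ (t `^ (a - 1) * (1 + h `^ p))); last by rewrite lerDl powR_ge0.
  by rewrite ler_wpM2l ?powR_ge0// le1D_powR.
rewrite /k1 /k2 [t < 1]ltNge t1/= mul0r !add0r powRrM [leRHS]addrC.
apply: tail_young => //; rewrite powR_gt0 ?(lt_le_trans _ t1)//=.
rewrite -opprB powRN invf_le1 ?powR_gt0 ?(lt_le_trans _ t1)//.
by apply: le_trans (ler_powR t1 (_ : 0 <= 1 - a)); rewrite ?powRr0// subr_ge0 ltW.
Qed.

Let int_k1 x : (\int[mu]_w (k1 (v (w - x)))%:E <= (ball_const q a)%:E)%E.
Proof.
have v1 := is_value1 hv.
rewrite (_ : (\int[mu]_w _)%E =
  (\int[mu]_(w in [set w | (v (w - x) < 1)%R]) (v (w - x) `^ (a - 1))%:E)%E).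
  apply: (@le_trans _ _ (\int[mu]_(w in [set w | (v (w - x) <= 1)%R]) (v (w - x) `^
    (a - 1))%:E)%E).
    apply: ge0_subset_integral => //.
    - exact: (measurable_open_ball hv).
    - exact: (measurable_closed_ball hv).
    - by apply: measurable_funTS; apply/measurable_EFinP;
        exact: (measurable_absv_powR hv).
    - by move=> w _; rewrite lee_fin powR_ge0.
    - by move=> w /= /ltW.
  by rewrite (integral_riesz_ball hv hmu a0)// powR1 mulr1.
rewrite [RHS]integral_mkcond; apply: eq_integral => w _.
rewrite patchE /k1; have [wx|wx] := boolP (v (w - x) < 1).
  by rewrite mem_set.
by rewrite memNset//; exact/negP.
Qed.

Let int_k2 r x : (a - 1) * (1 + r) + 1 < 0 -> (\int[mu]_w (k2 r (v (w - x)))%:E < +oo)%E.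
Proof.
move=> hr; have v1 := is_value1 hv.
rewrite (_ : (\int[mu]_w _)%E =
  (\int[mu]_(w in [set w | (1 <= v (w - x))%R]) (v (w - x) `^ ((a - 1) * (1 + r)))%:E)%E).
  by rewrite (integral_outside_ball hv hmu)// ltry.
rewrite [RHS]integral_mkcond; apply: eq_integral => w _.
rewrite patchE /k2; have [wx|wx] := boolP (1 <= v (w - x)).
  by rewrite mem_set.
by rewrite memNset//; exact/negP.
Qed.

(** Near x the kernel is integrable, so that its convolution with |f|^p
    is integrable and hence finite almost everywhere, and |f| <= 1 + |f|^p.  Far
    from x, Young's inequality bounds the product by |f|^p plus an integrable
    power of the distance. *)
Lemma riesz_ae_finite (f : K -> R) : measurable_fun [set: K] f ->
  (\int[mu]_w (`|f w| `^ p)%:E < +oo)%E ->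
  \forall x \ae mu, (\int[mu]_w (v (x - w) `^ (a - 1) * `|f w|)%:E < +oo)%E.
Proof.
move=> mf fp; have [r [r0 rp hr]] := tail_exponent.
pose h w := `|f w| `^ p.
have mh : measurable_fun [set: K] h.
  by apply: (measurableT_comp (measurable_powR p)); exact: measurableT_comp.
have h0 w : 0 <= h w by exact: powR_ge0.
have mkh : measurable_fun [set: K * K] (fun xw => (k1 (v (xw.2 - xw.1)) * h xw.2)%:E).
  apply/measurable_EFinP; apply: measurable_funM; last exact: (measurableT_comp mh).
  rewrite (_ : (fun _ => _) = (fun xw => k1 (v (xw.1 - xw.2)))).
    exact: (measurableT_comp mk1 (measurable_absv_dist hv)).
  by apply/funext => xw; rewrite (absv_distC hv).
have kh0 xw : (0 <= (k1 (v (xw.2 - xw.1)) * h xw.2)%:E)%E.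
  by rewrite lee_fin mulr_ge0.
have finV : (\int[mu]_x \int[mu]_w (k1 (v (w - x)) * h w)%:E < +oo)%E.
  have := fubini_tonelli (m1 := mu) (m2 := mu) _ mkh kh0 => /= ->.
  apply: (@le_lt_trans _ _ (\int[mu]_w ((ball_const q a)%:E * (h w)%:E))%E).
    apply: ge0_le_integral => //=.
    - by move=> w _; apply: integral_ge0 => x _; rewrite lee_fin mulr_ge0.
    - exact: (measurable_fun_fubini_tonelli_G (m1 := mu) _ mkh kh0).
    - by apply: measurable_funeM; exact/measurable_EFinP.
    - move=> w _; under eq_integral do rewrite mulrC EFinM (absv_distC hv).
      rewrite ge0_integralZl//.
      + by rewrite muleC; apply: lee_wpmul2r; rewrite ?lee_fin//; exact: int_k1.
      + apply/measurable_EFinP.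
        exact: (measurableT_comp mk1 (measurable_absvBr hv w)).
      + by move=> x _; rewrite lee_fin.
      + by rewrite lee_fin.
  rewrite ge0_integralZl//.
  - by apply: lte_mul_pinfty => //; rewrite lee_fin ltW// (ball_const_gt0 hv).
  - exact/measurable_EFinP.
  - by move=> w _; rewrite lee_fin.
  - by rewrite lee_fin ltW// (ball_const_gt0 hv).
have : mu.-integrable [set: K] (fun x => \int[mu]_w (k1 (v (w - x)) * h w)%:E)%E.
  apply/integrableP; split.
    exact: (measurable_fun_fubini_tonelli_F (m2 := mu) _ mkh kh0).
  apply: le_lt_trans finV; rewrite le_eqVlt; apply/orP; left; apply/eqP.
  apply: eq_integral => x _; rewrite gee0_abs//.
  by apply: integral_ge0 => w _; exact: (kh0 (x, w)).
move/integrable_ae => /(_ measurableT); apply: filterS => x /= /(_ I) Vx.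
have mdist g : measurable_fun [set: R] g ->
    measurable_fun [set: K] (fun w => (g (v (w - x)))%:E).
  move=> mg; apply/measurable_EFinP.
  exact: (measurableT_comp mg (measurable_absvBr hv x)).
have mh' : measurable_fun [set: K] (fun w => (h w)%:E) by exact/measurable_EFinP.
have mk1h : measurable_fun [set: K] (fun w => (k1 (v (w - x)) * h w)%:E).
  apply/measurable_EFinP; apply: measurable_funM => //.
  exact: (measurableT_comp mk1 (measurable_absvBr hv x)).
apply: (@le_lt_trans _ _ (\int[mu]_w ((k1 (v (w - x)))%:E + (k1 (v (w - x)) * h w)%:E
   + (k2 r (v (w - x)))%:E + (h w)%:E))%E).
  apply: ge0_le_integral => //=.
  - by move=> w _; rewrite lee_fin mulr_ge0 ?powR_ge0.
  - apply/measurable_EFinP; apply: measurable_funM; last exact: measurableT_comp.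
    rewrite (_ : (fun _ => _) = (fun w => v (w - x) `^ (a - 1))).
      exact: (measurable_absv_powR hv).
    by apply/funext => w; rewrite (absv_distC hv).
  - apply: emeasurable_funD => //; apply: emeasurable_funD; last exact: mdist.
    by apply: emeasurable_funD => //; exact: mdist.
  - move=> w _; rewrite -!EFinD lee_fin (absv_distC hv x).
    by apply: riesz_le => //; exact: (absv_ge0 hv).
rewrite !ge0_integralD//.
- apply: lte_add_pinfty; last exact: fp.
  apply: lte_add_pinfty; last exact: int_k2.
  apply: lte_add_pinfty; first exact: le_lt_trans (int_k1 x) (ltry _).
  by rewrite ltey_eq Vx.
- by move=> w _; rewrite lee_fin.
- exact: mdist.
- by move=> w _; rewrite lee_fin mulr_ge0.
- by move=> w _; rewrite -EFinD lee_fin addr_ge0// mulr_ge0.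
- by apply: emeasurable_funD => //; exact: mdist.
- by move=> w _; rewrite lee_fin.
- exact: mdist.
- by move=> w _; rewrite -!EFinD lee_fin !addr_ge0// mulr_ge0.
- apply: emeasurable_funD; last exact: mdist.
  by apply: emeasurable_funD => //; exact: mdist.
- by move=> w _; rewrite lee_fin.
Qed.

End Existence.

(** * Approximation of Borel sets by unions of balls of a fixed radius *)

Section PowerMeans.
Context {R : realType}.

Lemma powRD_le (p s t : R) : 0 <= p -> 0 <= s -> 0 <= t ->
  (s + t) `^ p <= 2 `^ p * (s `^ p + t `^ p).
Proof.
move=> p0 s0 t0; wlog st : s t s0 t0 / s <= t.
  move=> wlg; have [st|/ltW ts] := leP s t; first exact: wlg.
  by rewrite addrC [X in _ * X]addrC; exact: wlg.
apply: (@le_trans _ _ ((2 * t) `^ p)).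
  by apply: ge0_ler_powR; rewrite ?nnegrE ?addr_ge0 ?mulr_ge0//; lra.
by rewrite powRM// ler_wpM2l ?powR_ge0// lerDr powR_ge0.
Qed.

Lemma ereal_cvg0_le (u : nat -> \bar R) (e : R) : u @ \oo --> 0%E -> 0 < e ->
  exists N, forall n, (N <= n)%N -> (u n <= e%:E)%E.
Proof.
move=> /fine_cvgP[ufin /cvgr0Pnorm_le/(_ e)] + e0 => /(_ e0) ue.
have [N _ hN] : \forall n \near \oo, (u n <= e%:E)%E.
  near=> n; have un : u n \is a fin_num by near: n.
  rewrite -(fineK un) lee_fin; apply: le_trans (ler_norm _) _.
  by near: n.
by exists N => n; exact: hN.
Unshelve. all: by end_near.
Qed.

End PowerMeans.

Section Density.
Context {R : realType} {K : nonarchLocalFieldType}.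
Variables (v : K -> R) (q : nat).
Hypothesis hv : normalized_absolute_value v q.
Variable mu : {measure set K -> \bar R}.
Hypothesis hmu : normalized_haar_measure v mu.

Implicit Types x y : K.
Let Q : R := q%:R.

Let Q_gt1 : 1 < Q. Proof. by rewrite ltr1n (q_gt1 hv). Qed.
Let Q_gt0 : 0 < Q. Proof. exact: lt_trans Q_gt1. Qed.

(** For a set, seen as a predicate, this says that the set is a union of balls
    of radius q^(-n). *)
Definition ball_invariant T n (g : K -> T) :=
  forall x y, v (x - y) <= Q ^- n -> g x = g y.

Lemma ball_invariantW T m n (g : K -> T) : (m <= n)%N ->
  ball_invariant m g -> ball_invariant n g.
Proof.
move=> mn gm x y xy; apply: gm; apply: (le_trans xy).
by rewrite lef_pV2 ?posrE ?exprn_gt0// ler_weXn2l// ltW.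
Qed.

Section SetApproximation.
Variable D : set K.
Hypotheses (mD : measurable D) (finD : (mu D < +oo)%E).

Definition sym_diff (A E : set K) := (A `\` E) `|` (E `\` A).

Lemma measurable_sym_diff A E : measurable A -> measurable E ->
  measurable (sym_diff A E).
Proof. by move=> mA mE; apply: measurableU; exact: measurableD. Qed.

(** Approximation in measure inside the fixed set D of finite measure. *)
Definition set_approx (A : set K) := measurable A /\ forall e : R, 0 < e ->
  exists n (E : set K), [/\ measurable E, ball_invariant n E &
    (mu (sym_diff A E `&` D) <= e%:E)%E].

Let le_mu A B : measurable A -> measurable B -> A `<=` B -> (mu A <= mu B)%E.
Proof. by move=> mA mB AB; apply: le_measure; rewrite ?inE. Qed.

(** Continuity from above, which is why D has finite measure. *)
Lemma cvg_mu_exhaust (A : set K) (F : nat -> set K) : measurable A ->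
  (forall n, measurable (F n)) ->
  (forall m n, (m <= n)%N -> F m `<=` F n) ->
  A `<=` \bigcup_n F n ->
  (fun n => mu ((A `\` F n) `&` D)) @ \oo --> 0%E.
Proof.
move=> mA mF ndF AF.
have mADF n : measurable ((A `\` F n) `&` D) by apply: measurableI => //;
  exact: measurableD.
have cap0 : \bigcap_n ((A `\` F n) `&` D) = set0.
  apply/seteqP; split=> // x /= hx.
  have [[Ax _] _] := hx 0%N I; have [n _ Fnx] := AF _ Ax.
  by have [[_ +] _] := hx n I; apply.
rewrite -(@measure0 _ _ _ mu) -cap0; apply: nonincreasing_cvg_mu => //.
- by apply: le_lt_trans finD; apply: le_mu => // x [].
- by rewrite cap0.
- move=> m n mn; apply/subsetPset => x [[Ax nFx] Dx]; split=> //; split=> //.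
  by move=> Fmx; apply: nFx; exact: ndF Fmx.
Qed.

(** An open set U is the increasing union of the sets of those points
    whose ball of radius q^(-n) is contained in U; by the ultrametric inequality
    these sets are unions of such balls. *)
Lemma set_approx_open (U : set K) : open U -> set_approx U.
Proof.
move=> oU; have mU := measurable_open oU; split=> // e e0.
pose F n := [set x | forall y, v (x - y) <= Q ^- n -> U y].
have FU n : F n `<=` U.
  by move=> x; apply; rewrite subrr (absv0 hv) invr_ge0 exprn_ge0// ltW.
(* Two points of a ball of radius q^(-n) have the same such ball around them. *)
have invF n : ball_invariant n (F n).
  have sub x y : v (x - y) <= Q ^- n -> F n x -> F n y.
    move=> xy Fx z yz; apply: Fx; apply: le_trans (absv_ultra hv y _ _) _.
    by rewrite ge_max xy.
  move=> x y xy; apply/propext; split; first exact: sub.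
  by apply: sub; rewrite (absv_distC hv).
have mF n : measurable (F n).
  apply: measurable_open; rewrite openE => x Fx; apply/(absv_nbhsE hv).
  exists (Q ^- n); first by rewrite invr_gt0 exprn_gt0.
  by move=> y /= /ltW yx; rewrite (invF n y x).
have [N hN] : exists N, forall n, (N <= n)%N -> (mu ((U `\` F n) `&` D) <= e%:E)%E.
  apply: ereal_cvg0_le => //; apply: cvg_mu_exhaust => //.
    move=> m n mn x Fx y xy; apply: Fx; apply: (le_trans xy).
    by rewrite lef_pV2 ?posrE ?exprn_gt0// ler_weXn2l// ltW.
  move=> x Ux.
  have /(absv_nbhsE hv)[r r0 rU] : nbhs x U by exact: open_nbhs_nbhs.
  have [n hn] := qVX_lt hv r0; exists n => // y xy; apply: rU => /=.
  by rewrite (absv_distC hv); exact: le_lt_trans hn.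
exists N, (F N); split => //.
have -> : sym_diff U (F N) = U `\` F N.
  by rewrite /sym_diff [X in _ `|` X](_ : _ = set0) ?setU0// setD_eq0.
exact: hN.
Qed.

Lemma set_approxC A : set_approx A -> set_approx (~` A).
Proof.
move=> [mA hA]; split; first exact: measurableC.
move=> e /hA[n [E [mE invE AE]]]; exists n, (~` E); split.
- exact: measurableC.
- by move=> x y /invE xy; rewrite /setC/= /mkset xy.
- have -> : sym_diff (~` A) (~` E) = sym_diff A E; last by [].
  by rewrite /sym_diff !setDE !setCK setUC; congr (_ `|` _); rewrite setIC.
Qed.

Lemma set_approxU A B : set_approx A -> set_approx B -> set_approx (A `|` B).
Proof.
move=> [mA hA] [mB hB]; split; first exact: measurableU.
move=> e e0; have e20 : 0 < e / 2 by rewrite divr_gt0.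
have [m [E [mE invE AE]]] := hA _ e20; have [n [F [mF invF BF]]] := hB _ e20.
exists (maxn m n), (E `|` F); split; first exact: measurableU.
  move=> x y xy; rewrite /setU/= /mkset.
  rewrite (ball_invariantW (leq_maxl m n) invE xy).
  by rewrite (ball_invariantW (leq_maxr m n) invF xy).
have mAE := measurable_sym_diff mA mE; have mBF := measurable_sym_diff mB mF.
apply: (@le_trans _ _ (mu ((sym_diff A E `&` D) `|` (sym_diff B F `&` D)))).
  apply: le_mu.
  - by apply: measurableI => //; apply: measurable_sym_diff; exact: measurableU.
  - by apply: measurableU; exact: measurableI.
  - move=> x [[|] [hx1 hx2] Dx].
      move: hx1 => [Ax|Bx]; [left|right]; split=> //; left; split=> // ?; apply: hx2.
        by left.
      by right.
    move: hx1 => [Ax|Bx]; [left|right]; split=> //; right; split=> // ?; apply: hx2.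
      by left.
    by right.
rewrite [e]splitr EFinD; apply: le_trans (leeD AE BF).
by apply: measureU2; exact: measurableI.
Qed.

Lemma set_approx_bigcup (A : nat -> set K) : (forall n, set_approx (A n)) ->
  set_approx (\bigcup_n A n).
Proof.
move=> hA; have mA : measurable (\bigcup_n A n).
  by apply: bigcupT_measurable => n; case: (hA n).
split=> // e e0; have e20 : 0 < e / 2 by rewrite divr_gt0.
pose F n := \big[setU/set0]_(i < n) A i.
have hF n : set_approx (F n).
  rewrite /F; elim/big_ind : _ => //; last exact: set_approxU.
  exact/set_approx_open/open0.
have mF n : measurable (F n) by case: (hF n).
have [N hN] : exists N, forall n, (N <= n)%N ->
    (mu ((\bigcup_n A n `\` F n) `&` D) <= (e / 2)%:E)%E.
  apply: ereal_cvg0_le => //; apply: cvg_mu_exhaust => //.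
    by move=> m n mn; exact: subset_bigsetU.
  move=> x [n _ Anx]; exists n.+1 => //.
  by rewrite /F big_ord_recr/=; right.
have [_ /(_ _ e20)[n [E [mE invE FE]]]] := hF N.
exists n, E; split=> //.
have mFE := measurable_sym_diff (mF N) mE.
apply: (@le_trans _ _ (mu (((\bigcup_n A n `\` F N) `&` D) `|` (sym_diff (F N) E `&`
  D)))).
  apply: le_mu.
  - by apply: measurableI => //; exact: measurable_sym_diff.
  - apply: measurableU; apply: measurableI => //; exact: measurableD.
  - move=> x [[[Ax nEx]|[Ex nAx]] Dx].
      by have [Fx|nFx] := pselect (F N x); [right; split=> //; left|left].
    right; split=> //; right; split=> // Fx; apply: nAx.
    by move: Fx; rewrite /F -bigcup_mkord => -[i _ Aix]; exists i.
rewrite [e]splitr EFinD; apply: le_trans (leeD (hN N (leqnn N)) FE).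
by apply: measureU2; apply: measurableI => //; exact: measurableD.
Qed.

(** The sets that can be approximated form a sigma-algebra containing
    the open sets. *)
Lemma measurable_set_approx A : measurable A -> set_approx A.
Proof.
move=> mA; suff : <<s @open K >> `<=` set_approx by apply.
apply: smallest_sub; last by move=> U; exact: set_approx_open.
split.
- exact/set_approx_open/open0.
- by move=> B; rewrite setTD; exact: set_approxC.
- exact: set_approx_bigcup.
Qed.

End SetApproximation.
End Density.

(** * Density in L^p of functions constant on balls *)

Import HBNNSimple.

Section LpTriangle.
Context {R : realType} {d : measure_display} {T : measurableType d}.

Lemma measurable_norm_powR (p : R) (f : T -> R) : measurable_fun [set: T] f ->
  measurable_fun [set: T] (fun x => (`|f x| `^ p)%:E).
Proof.
move=> mf; apply/measurable_EFinP; apply: (measurableT_comp (measurable_powR p)).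
exact: measurableT_comp.
Qed.

Variables (mu : {measure set T -> \bar R}) (p : R).
Hypothesis p1 : 1 <= p.

Let p0 : 0 < p. Proof. exact: lt_le_trans p1. Qed.

Lemma Lp_dist_triangle (f g h : T -> R) (r s : R) :
  measurable_fun [set: T] f -> measurable_fun [set: T] g -> measurable_fun [set: T] h ->
  (\int[mu]_x (`|f x - g x| `^ p)%:E <= r%:E)%E ->
  (\int[mu]_x (`|g x - h x| `^ p)%:E <= s%:E)%E ->
  (\int[mu]_x (`|f x - h x| `^ p)%:E <= (2 `^ p * (r + s))%:E)%E.
Proof.
move=> mf mg mh fg gh.
have mfg := measurable_norm_powR p (measurable_funB mf mg).
have mgh := measurable_norm_powR p (measurable_funB mg mh).
have mfh := measurable_norm_powR p (measurable_funB mf mh).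
apply: (@le_trans _ _ (\int[mu]_x ((2 `^ p)%:E *
   ((`|f x - g x| `^ p)%:E + (`|g x - h x| `^ p)%:E)))%E).
  apply: ge0_le_integral => //=.
  - by apply: measurable_funeM; exact: emeasurable_funD.
  - move=> x _; rewrite -EFinD -EFinM lee_fin.
    apply: le_trans (powRD_le (ltW p0) (normr_ge0 _) (normr_ge0 _)).
    apply: ge0_ler_powR; rewrite ?nnegrE ?addr_ge0 ?(ltW p0)//.
    by rewrite -(subrKA (g x)); exact: ler_normD.
rewrite ge0_integralZl//; last 2 first.
- exact: emeasurable_funD.
- by move=> x _; rewrite -EFinD lee_fin addr_ge0 ?powR_ge0.
rewrite ge0_integralD//.
by rewrite EFinM EFinD; apply: lee_wpmul2l; [rewrite lee_fin powR_ge0|exact: leeD].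
Qed.

End LpTriangle.

Section LpDensity.
Context {R : realType} {K : nonarchLocalFieldType}.
Variables (v : K -> R) (q : nat).
Hypothesis hv : normalized_absolute_value v q.
Variable mu : {measure set K -> \bar R}.
Hypothesis hmu : normalized_haar_measure v mu.
Variable p : R.
Hypothesis p1 : 1 <= p.

Implicit Types x y : K.
Let Q : R := q%:R.

Let Q_gt1 : 1 < Q. Proof. by rewrite ltr1n (q_gt1 hv). Qed.
Let Q_gt0 : 0 < Q. Proof. exact: lt_trans Q_gt1. Qed.
Let p0 : 0 < p. Proof. exact: lt_le_trans p1. Qed.

Definition Lp_approx (f : K -> R) := measurable_fun [set: K] f /\
  forall e : R, 0 < e -> exists n (g : K -> R),
    [/\ measurable_fun [set: K] g, ball_invariant v q n g &
        (\int[mu]_x (`|f x - g x| `^ p)%:E <= e%:E)%E].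

Let scaled_e (e : R) : 0 < e -> 0 < e / 2 `^ p / 2.
Proof. by move=> e0; rewrite !divr_gt0// powR_gt0. Qed.

Let scaled_eE (e : R) : 2 `^ p * (e / 2 `^ p / 2 + e / 2 `^ p / 2) = e.
Proof. by rewrite -splitr mulrC divfK// gt_eqF// powR_gt0. Qed.

Lemma Lp_approx_closed (f : K -> R) : measurable_fun [set: K] f ->
  (forall e : R, 0 < e -> exists g, Lp_approx g /\
    (\int[mu]_x (`|f x - g x| `^ p)%:E <= e%:E)%E) -> Lp_approx f.
Proof.
move=> mf hf; split=> // e e0.
have [g [[mg hg] fg]] := hf _ (scaled_e e0).
have [n [h [mh invh gh]]] := hg _ (scaled_e e0).
exists n, h; split=> //.
by rewrite -(scaled_eE e); exact: (Lp_dist_triangle p1 mf mg mh).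
Qed.

Lemma Lp_approxD f g : Lp_approx f -> Lp_approx g ->
  Lp_approx (fun x => f x + g x).
Proof.
move=> [mf hf] [mg hg]; split; first exact: measurable_funD.
move=> e e0; have [m [f' [mf' invf ff']]] := hf _ (scaled_e e0).
have [n [g' [mg' invg gg']]] := hg _ (scaled_e e0).
exists (maxn m n), (fun x => f' x + g' x); split.
- exact: measurable_funD.
- move=> x y xy; rewrite (ball_invariantW hv (leq_maxl m n) invf xy).
  by rewrite (ball_invariantW hv (leq_maxr m n) invg xy).
rewrite -(scaled_eE e).
apply: (@Lp_dist_triangle _ _ _ _ _ p1 _ (fun x => f' x + g x) _).
- exact: measurable_funD.
- exact: measurable_funD.
- exact: measurable_funD.
- rewrite (eq_integral (fun x => (`|f x - f' x| `^ p)%:E))// => x _.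
  by congr ((`|_| `^ _)%:E); ring.
- rewrite (eq_integral (fun x => (`|g x - g' x| `^ p)%:E))// => x _.
  by congr ((`|_| `^ _)%:E); ring.
Qed.

Lemma Lp_approxZ c f : Lp_approx f -> Lp_approx (fun x => c * f x).
Proof.
move=> [mf hf]; split; first exact: measurable_funM.
move=> e e0; have c0 : 0 < `|c| `^ p + 1 by rewrite ltr_wpDl ?powR_ge0.
have [n [g [mg invg fg]]] := hf _ (divr_gt0 e0 c0).
exists n, (fun x => c * g x); split.
- exact: measurable_funM.
- by move=> x y /invg ->.
under eq_integral do rewrite -mulrBr normrM powRM// EFinM.
rewrite ge0_integralZl//; last by apply: measurable_norm_powR; exact: measurable_funB.
apply: (@le_trans _ _ ((`|c| `^ p)%:E * (e / (`|c| `^ p + 1))%:E)%E).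
  by apply: lee_wpmul2l; rewrite // lee_fin powR_ge0.
rewrite -EFinM lee_fin mulrCA ler_piMr ?(ltW e0)//.
by rewrite ler_pdivrMr// mul1r lerDl.
Qed.

Lemma Lp_approx0 : Lp_approx (fun=> 0).
Proof.
split=> // e e0; exists 0%N, (fun=> 0); split=> //.
under eq_integral do rewrite subrr normr0 powR0 ?gt_eqF//.
by rewrite integral0 lee_fin ltW.
Qed.

Let D m : set K := [set y | v (y - 0) <= Q ^+ m].

Let valueX m : is_value v (Q ^+ m).
Proof.
exact: (is_value_qX hv).
Qed.

Let mD m : measurable (D m). Proof. exact: (measurable_closed_ball hv). Qed.

Let finD m : (mu (D m) < +oo)%E.
Proof. by rewrite (haar_closed_ball hv hmu)// ltry. Qed.

Let D_invariant m n : ball_invariant v q n (D m).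
Proof.
have sub x y : v (x - y) <= Q ^- n -> D m x -> D m y.
  rewrite /D/= => xy Dx; apply: le_trans (absv_ultra hv x _ _) _.
  rewrite ge_max Dx andbT (absv_distC hv); apply: (le_trans xy).
  apply: (@le_trans _ _ 1); last by rewrite exprn_ege1// ltW.
  by rewrite invf_le1 ?exprn_gt0// exprn_ege1// ltW.
move=> x y xy; apply/propext; split; first exact: sub.
by apply: sub; rewrite (absv_distC hv).
Qed.

Lemma Lp_approx_indic m A : measurable A -> Lp_approx \1_(A `&` D m).
Proof.
move=> mA; split; first by apply: measurable_indic; exact: measurableI.
move=> e /(proj2 (measurable_set_approx hv (mD m) (finD m) mA))[n [E [mE invE AE]]].
exists n, \1_(E `&` D m); split.
- by apply: measurable_indic; exact: measurableI.
- move=> x y xy; rewrite !indicE; congr ((nat_of_bool _)%:R).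
  apply/idP/idP; rewrite !inE /setI/= /mkset.
    by rewrite (invE _ _ xy) (@D_invariant m n x y xy).
  by rewrite (invE _ _ xy) (@D_invariant m n x y xy).
- have mS : measurable (sym_diff A E `&` D m).
    by apply: measurableI => //; exact: measurable_sym_diff.
  apply: le_trans AE.
  have <- : (\int[mu]_x (\1_(sym_diff A E `&` D m) x)%:E = mu (sym_diff A E `&` D m))%E.
    by rewrite integral_indic// setIT.
  rewrite le_eqVlt; apply/orP; left; apply/eqP; apply: eq_integral => x _.
  rewrite !indicE; congr (_%:E).
  have [Dx|nDx] := pselect (D m x); last first.
    by rewrite !memNset ?subrr ?normr0 ?powR0 ?gt_eqF// => -[].
  have [Ax|nAx] := pselect (A x); have [Ex|nEx] := pselect (E x).
  - rewrite [x \in A `&` _]mem_set// [x \in E `&` _]mem_set// memNset ?subrr ?normr0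
      ?powR0 ?gt_eqF//.
    by move=> [[[]|[]]].
  - rewrite [x \in A `&` _]mem_set// [x \in E `&` _]memNset; last by move=> [].
    by rewrite mem_set ?subr0 ?normr1 ?powR1//; split=> //; left.
  - rewrite [x \in A `&` _]memNset; last by move=> [].
    rewrite [x \in E `&` _]mem_set// mem_set ?sub0r ?normrN ?normr1 ?powR1//.
    by split=> //; right.
  - rewrite !memNset ?subrr ?normr0 ?powR0 ?gt_eqF//; try by case.
    by move=> [[[]|[]]].
Qed.

Lemma Lp_approx_nnsfun m (f : {nnsfun K >-> R}) :
  Lp_approx (fun x => f x * \1_(D m) x).
Proof.
have -> : (fun x => f x * \1_(D m) x) =
    (fun x => \sum_(y <- finmap.enum_fset (fset_set (range f))) y * \1_(f @^-1` [set
      y] `&` D m) x).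
  apply/funext => x; rewrite {1}(fimfunE f) fsbig_finite//= big_distrl/=.
  by apply: eq_bigr => y _; rewrite -mulrA indicI.
elim: (finmap.enum_fset _) => [|y s ih].
  under eq_fun do rewrite big_nil; exact: Lp_approx0.
under eq_fun do rewrite big_cons; apply: Lp_approxD ih.
by apply/Lp_approxZ/Lp_approx_indic.
Qed.

(** Simple functions increasing to f, cut off outside growing balls,
    converge to f in L^p by dominated convergence. *)
Lemma Lp_approx_ge0 (f : K -> R) : measurable_fun [set: K] f ->
  (forall x, 0 <= f x) -> (\int[mu]_x (f x `^ p)%:E < +oo)%E -> Lp_approx f.
Proof.
move=> mf f0 fp.
have mf' : measurable_fun [set: K] (EFin \o f) by exact/measurable_EFinP.
pose phi := nnsfun_approx measurableT mf'.
have f0' x : [set: K] x -> (0 <= (EFin \o f) x)%E by rewrite /= lee_fin.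
have phi_le n x : phi n x <= f x.
  by rewrite /phi nnsfun_approxE -lee_fin; exact: (le_approx n f0' I).
pose g n x := phi n x * \1_(D n) x.
have mg n : measurable_fun [set: K] (g n) by case: (Lp_approx_nnsfun n (phi n)).
have g0 n x : 0 <= g n x by rewrite mulr_ge0.
have g_le n x : g n x <= f x.
  apply: le_trans (phi_le n x); by rewrite ler_piMr.
have g_cvg x : \forall n \near \oo, g n x = phi n x.
  have [N hN] := qX_gt hv (v (x - 0)).
  exists N => // n /= Nn; rewrite /g indicE mem_set ?mulr1//=.
  by apply: (le_trans (ltW hN)); rewrite ler_weXn2l// ltW.
have cvg0 : (fun n => \int[mu]_x (`|f x - g n x| `^ p)%:E)%E @ \oo --> 0%E.
  have -> : 0%E = (\int[mu]_(x in [set: K]) cst 0 x)%E :> \bar R by rewrite integral0.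
  apply: (@dominated_cvg _ _ _ mu _ measurableT _ _ (fun x => (f x `^ p)%:E)).
  - move=> n; by apply: measurable_norm_powR; exact: measurable_funB.
  - move=> x _ /=; apply: cvg_EFin; first exact: nearW.
    have phix : phi n x @[n --> \oo] --> f x.
      have := @cvg_nnsfun_approx _ _ _ _ measurableT _ mf' f0' x I.
      by move/fine_cvgP => [].
    apply/cvgr0Pnorm_lt => e e0; have e10 : 0 < Num.min e 1 by rewrite lt_min e0 /=.
    near=> n => /=; have -> : g n x = phi n x by near: n.
    have : `|f x - phi n x| < Num.min e 1.
      by near: n; move/cvgrPdist_lt : phix => /(_ _ e10).
    rewrite lt_min => /andP[te t1]; rewrite ger0_norm ?powR_ge0//.
    apply: le_lt_trans te; have [->|t0] := eqVneq (f x - phi n x) 0.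
      by rewrite normr0 powR0// gt_eqF.
    by apply: ge1r_powR => //; rewrite normr_gt0 t0 ltW.
  - by [].
  - apply/integrableP; split.
      by apply/measurable_EFinP; exact: (measurableT_comp (measurable_powR p)).
    by under eq_integral do rewrite gee0_abs ?lee_fin ?powR_ge0//.
  - move=> n x _; rewrite gee0_abs ?lee_fin ?powR_ge0//.
    apply: ge0_ler_powR; rewrite ?nnegrE ?(ltW p0)//.
    by rewrite ger0_norm ?subr_ge0// lerBlDr lerDl.
apply: Lp_approx_closed => // e e0.
have [N hN] := ereal_cvg0_le cvg0 e0.
by exists (g N); split; [exact: Lp_approx_nnsfun|exact: hN].
Unshelve. all: by end_near.
Qed.

Lemma Lp_density (f : K -> R) : measurable_fun [set: K] f ->
  (\int[mu]_x (`|f x| `^ p)%:E < +oo)%E -> Lp_approx f.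
Proof.
move=> mf fp.
have part (g : K -> R) : measurable_fun [set: K] g -> (forall x, 0 <= g x) ->
    (forall x, g x <= `|f x|) -> Lp_approx g.
  move=> mg g0 gf; apply: Lp_approx_ge0 => //; apply: le_lt_trans fp.
  apply: ge0_le_integral => //.
  - by move=> x _; rewrite lee_fin powR_ge0.
  - by apply/measurable_EFinP; exact: (measurableT_comp (measurable_powR p)).
  - exact: measurable_norm_powR.
  - by move=> x _; rewrite lee_fin; apply: ge0_ler_powR; rewrite ?nnegrE ?(ltW p0).
have mnf : measurable_fun [set: K] (fun x => `|f x|) by exact: measurableT_comp.
have f_bounds x : - `|f x| <= f x <= `|f x| by rewrite -ler_norml.
(* The positive and negative parts of f, written with the absolute value. *)
have -> : f = (fun x => 2^-1 * (`|f x| + f x) + (-1) * (2^-1 * (`|f x| - f x))).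
  by apply/funext => x; field.
apply: Lp_approxD; [|apply: Lp_approxZ]; apply: part => [|x|x];
  try by have /andP[] := f_bounds x; lra.
- by apply: measurable_funM => //; exact: measurable_funD.
- by apply: measurable_funM => //; exact: measurable_funB.
Qed.

End LpDensity.

(** * The approximate identity and the error estimate *)

Section ApproxIdentity.
Context {R : realType} {K : nonarchLocalFieldType}.
Variables (v : K -> R) (q : nat).
Hypothesis hv : normalized_absolute_value v q.
Variable mu : {sigma_finite_measure set K -> \bar R}.
Hypothesis hmu : normalized_haar_measure v mu.
Variable a : R.
Hypotheses (a0 : 0 < a) (a1 : a < 1).

Implicit Types x w y : K.

Let Q : R := q%:R.
Let B : R := ball_const q a.
Let cd : R := fracdiff_const q a * riesz_const q a.

Let B_gt0 : 0 < B. Proof. exact: (ball_const_gt0 hv). Qed.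
Let Q_gt1 : 1 < Q. Proof. by rewrite ltr1n (q_gt1 hv). Qed.
Let Q_gt0 : 0 < Q. Proof. exact: lt_trans Q_gt1. Qed.

(** The integral of [approx_kernel]; with z = q^alpha it is a rational
    identity in z and q. *)
Lemma approx_kernel_const : cd * (Q^-1 - B ^+ 2 * Q `^ (- a)) = 1.
Proof.
have z1 : 1 < Q `^ a.
  rewrite /powR gt_eqF// expR_gt1 mulr_gt0// ln_gt0//.
have zQ : Q `^ a < Q.
  rewrite -[ltRHS](powRr1 (ltW Q_gt0)) /powR gt_eqF// ltr_expR ltr_pM2r// ln_gt0//.
rewrite /cd /fracdiff_const /riesz_const /B /ball_const -/Q.
have -> : Q `^ (a - 1) = Q `^ a / Q.
  by rewrite -[X in _ = _ / X](powRr1 (ltW Q_gt0)) -powRB// (gt_eqF Q_gt0) implybT.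
have -> : Q `^ (- a - 1) = (Q `^ a)^-1 / Q.
  rewrite -[X in _ = _ / X](powRr1 (ltW Q_gt0)) -powRN -powRB//.
  by rewrite (gt_eqF Q_gt0) implybT.
rewrite powRN; set z := Q `^ a in z1 zQ *.
have z0 : 0 < z by exact: lt_trans z1.
field; rewrite !gt_eqF ?subr_gt0//.
by rewrite -[ltLHS]mulr1 ltr_pM.
Qed.

Lemma approx_kernel_outside eps t : eps <= t -> approx_kernel q a eps t = 0.
Proof. by move=> et; rewrite /approx_kernel /outside_kernel ltNge et subrr mulr0. Qed.

Lemma approx_kernel_inside eps t : t < eps -> approx_kernel q a eps t =
  cd * (eps^-1 - B * eps `^ (- a) * t `^ (a - 1)).
Proof. by move=> te; rewrite /approx_kernel /outside_kernel te. Qed.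

Let ball x eps : set K := [set w | v (w - x) < eps].

Let mball x eps : measurable (ball x eps).
Proof. exact: (measurable_open_ball hv). Qed.

Let mpow x D : measurable_fun D (fun w => (v (w - x) `^ (a - 1))%:E).
Proof.
by apply: measurable_funTS; apply/measurable_EFinP; exact: (measurable_absv_powR hv).
Qed.

Lemma integral_riesz_open_ball x eps : is_value v eps ->
  (\int[mu]_(w in [set w | (v (w - x) < eps)%R]) (v (w - x) `^ (a - 1))%:E =
   (B * eps `^ a * Q `^ (- a))%:E)%E.
Proof.
move=> veps; have e0 := value_gt0 hv veps.
have -> : [set w | v (w - x) < eps] = [set w | v (w - x) <= eps / Q].
  case: veps => c c0 <-; apply/seteqP; split=> y /=; first exact: (absv_discrete hv).
  move=> /le_lt_trans; apply; rewrite gtr_pMr ?(absv_gt0 hv)//.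
  by rewrite invf_lt1.
rewrite (integral_riesz_ball hv hmu a0); last exact: (is_value_divq hv).
rewrite -/B powRM ?invr_ge0 ?ltW//.
rewrite -[Q^-1](powR_inv1 (ltW Q_gt0)) -powRrM mulN1r mulrA//.
Qed.

(** A bound for the L^1 norm of [approx_kernel] that does not depend on eps. *)
Definition approx_kernel_mass : R := `|cd| * (Q^-1 + B ^+ 2 * Q `^ (- a)).

Lemma approx_kernel_mass_gt0 : 0 < approx_kernel_mass.
Proof.
apply: mulr_gt0; last first.
  by apply: addr_gt0; rewrite ?invr_gt0//; apply: mulr_gt0; rewrite ?powR_gt0 ?exprn_gt0.
rewrite normr_gt0; apply: contra_eq_neq approx_kernel_const => ->.
by rewrite mul0r eq_sym oner_eq0.
Qed.

Let measurable_kernel eps x : measurable_fun [set: K] (fun w => approx_kernel q a eps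
  (v (w - x))).
Proof.
exact: (measurableT_comp (measurable_approx_kernel q a eps) (measurable_absvBr hv x)).
Qed.

Lemma approx_kernel_mass_le eps x : is_value v eps ->
  (\int[mu]_w (`|approx_kernel q a eps (v (w - x))|)%:E <= approx_kernel_mass%:E)%E.
Proof.
move=> veps; have e0 := value_gt0 hv veps.
have eV0 : 0 <= eps^-1 by rewrite invr_ge0 ltW.
have C0 : 0 <= B * eps `^ (- a) by rewrite mulr_ge0 ?powR_ge0// ltW.
have -> : (\int[mu]_w (`|approx_kernel q a eps (v (w - x))|)%:E =
    \int[mu]_(w in ball x eps) (`|approx_kernel q a eps (v (w - x))|)%:E)%E.
  rewrite [RHS]integral_mkcond; apply: eq_integral => w _.
  rewrite patchE; have [we|we] := boolP (v (w - x) < eps).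
    by rewrite mem_set.
  rewrite memNset; last exact/negP.
  by rewrite approx_kernel_outside ?normr0// leNgt.
apply: (@le_trans _ _ (\int[mu]_(w in ball x eps) (`|cd|%:E * ((eps^-1)%:E +
   (B * eps `^ (- a))%:E * (v (w - x) `^ (a - 1))%:E)))%E).
  apply: ge0_le_integral => //.
  - by apply: measurable_funTS; apply/measurable_EFinP; apply: measurableT_comp.
  - apply: measurable_funeM; apply: emeasurable_funD => //; exact: measurable_funeM.
  - move=> w /= we; rewrite -(EFinM (B * _)) -EFinD -EFinM lee_fin approx_kernel_inside//.
    rewrite normrM ler_wpM2l//; apply: le_trans (ler_normB _ _) _.
    by rewrite (ger0_norm eV0) ger0_norm// mulr_ge0 ?powR_ge0.
have mm : measurable_fun (ball x eps)
    (fun w => (B * eps `^ (- a))%:E * (v (w - x) `^ (a - 1))%:E)%E.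
  exact: measurable_funeM.
rewrite ge0_integralZl//; last 2 first.
- exact: emeasurable_funD.
- by move=> w _; rewrite -EFinM -EFinD lee_fin addr_ge0// mulr_ge0 ?powR_ge0.
rewrite ge0_integralD//; last first.
  by move=> w _; rewrite -EFinM lee_fin mulr_ge0 ?powR_ge0.
rewrite ge0_integralZl//; last by move=> w _; rewrite lee_fin powR_ge0.
rewrite integral_riesz_open_ball// integral_cst// (haar_open_ball hv hmu)//.
rewrite -(EFinM eps^-1) -(EFinM (B * _)) -EFinD -EFinM lee_fin /approx_kernel_mass.
have -> : eps^-1 * (eps / q%:R) = Q^-1 by rewrite mulKf// gt_eqF.
have -> : B * eps `^ (- a) * (B * eps `^ a * Q `^ (- a)) = B ^+ 2 * Q `^ (- a).
  by rewrite powRN; field; rewrite gt_eqF// powR_gt0.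
by [].
Qed.

Lemma approx_kernel_integrable eps x : is_value v eps ->
  mu.-integrable [set: K] (EFin \o (fun w => approx_kernel q a eps (v (w - x)))).
Proof.
move=> veps; apply/integrableP; split; first exact/measurable_EFinP.
exact: le_lt_trans (approx_kernel_mass_le x veps) (ltry _).
Qed.

Lemma approx_kernel_integral eps x : is_value v eps ->
  Rintegral mu [set: K] (fun w => approx_kernel q a eps (v (w - x))) = 1.
Proof.
move=> veps; have e0 := value_gt0 hv veps.
have -> : Rintegral mu [set: K] (fun w => approx_kernel q a eps (v (w - x))) =
    Rintegral mu (ball x eps) (fun w =>
      cd * (eps^-1 - B * eps `^ (- a) * v (w - x) `^ (a - 1))).
  rewrite [RHS]Rintegral_mkcond; congr Rintegral; apply/funext => w.
  rewrite patchE; have [we|we] := boolP (v (w - x) < eps).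
    by rewrite mem_set// approx_kernel_inside.
  rewrite memNset; last exact/negP.
  by rewrite approx_kernel_outside// leNgt.
have int1 : mu.-integrable (ball x eps) (EFin \o (fun=> eps^-1)).
  apply/integrableP; split; first exact: measurable_cst.
  rewrite integral_cst//= (haar_open_ball hv hmu)// -EFinM; exact: ltry.
have int2 : mu.-integrable (ball x eps) (EFin \o (fun w => v (w - x) `^ (a - 1))).
  apply/integrableP; split; first exact: mpow.
  under eq_integral do rewrite gee0_abs ?lee_fin ?powR_ge0//.
  by rewrite integral_riesz_open_ball// ltry.
have int3 : mu.-integrable (ball x eps) (EFin \o
    (fun w => B * eps `^ (- a) * v (w - x) `^ (a - 1))).
  rewrite (_ : _ \o _ = (fun w => (B * eps `^ (- a))%:E *
    (EFin \o (fun w => (v (w - x) `^ (a - 1))%R)) w)%E); first exact: integrableZl.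
  by apply/funext => w /=; rewrite EFinM.
have int4 : mu.-integrable (ball x eps) (EFin \o
    (fun w => eps^-1 - B * eps `^ (- a) * v (w - x) `^ (a - 1))).
  rewrite (_ : _ \o _ = ((EFin \o (fun=> (eps^-1)%R)) \-
    (EFin \o (fun w => (B * eps `^ (- a) * v (w - x) `^ (a - 1))%R)))%E).
    exact: integrableB.
  by apply/funext => w /=; rewrite EFinB.
rewrite RintegralZl// RintegralB// RintegralZl// Rintegral_cst//.
rewrite /Rintegral integral_riesz_open_ball// (haar_open_ball hv hmu)//=.
rewrite -[RHS]approx_kernel_const; congr (_ * (_ - _)).
  by rewrite mulKf// gt_eqF.
by rewrite powRN; field; rewrite gt_eqF// powR_gt0.
Qed.

Section ErrorBound.
Variable p : R.
Hypotheses (p1 : 1 <= p) (pa : p < 1 / a).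

Let p0 : 0 < p. Proof. exact: lt_le_trans p1. Qed.

Definition Rerr (f : K -> R) (nu : nat) x : R :=
  Rfracdiff v q mu a (Q ^- nu) (Rriesz v q mu a f) x - f x.

Lemma measurable_Rriesz f : measurable_fun [set: K] f ->
  measurable_fun [set: K] (Rriesz v q mu a f).
Proof.
move=> mf; apply: measurable_funM => //.
apply: (@measurable_Rintegral_section _ _ _ mu
  (fun xy => v (xy.1 - xy.2) `^ (a - 1) * f xy.2)).
apply: measurable_funM; last exact: (measurableT_comp mf).
exact: (measurableT_comp (measurable_powR (a - 1)) (measurable_absv_dist hv)).
Qed.

Lemma measurable_Rfracdiff eps u : measurable_fun [set: K] u ->
  measurable_fun [set: K] (Rfracdiff v q mu a eps u).
Proof.
move=> mfu; rewrite (funext (Rfracdiff_mkcond v q mu a eps u)).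
apply: measurable_funM => //.
apply: (@measurable_Rintegral_section _ _ _ mu
  (fun xy => fracdiff_kernel a eps (v (xy.2 - xy.1)) * (u xy.2 - u xy.1))).
apply: measurable_funM; last first.
  by apply: measurable_funB; exact: (measurableT_comp mfu).
rewrite (_ : (fun _ => _) = (fun xy => fracdiff_kernel a eps (v (xy.1 - xy.2)))).
  exact: (measurableT_comp (measurable_fracdiff_kernel a eps) (measurable_absv_dist hv)).
by apply/funext => xy; rewrite (absv_distC hv).
Qed.

Lemma measurable_Rerr f nu : measurable_fun [set: K] f ->
  measurable_fun [set: K] (Rerr f nu).
Proof.
by move=> mf; apply: measurable_funB => //; apply: measurable_Rfracdiff;
  exact: measurable_Rriesz.
Qed.

(** The kernel has integral 1, so that the error at x is the integral of the
    kernel against f(w) - f(x); on the support of the kernel g(w) = g(x), whence f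
    may be replaced by f - g. *)
Lemma Rerr_pointwise (f g : K -> R) n nu x :
  measurable_fun [set: K] f -> measurable_fun [set: K] g ->
  ball_invariant v q n g -> (n <= nu)%N ->
  (\int[mu]_w (v (x - w) `^ (a - 1) * `|f w|)%:E < +oo)%E ->
  (`|Rerr f nu x|%:E <=
   \int[mu]_w (`|approx_kernel q a (Q ^- nu) (v (w - x))| * `|f w - g w|)%:E +
   (approx_kernel_mass * `|f x - g x|)%:E)%E.
Proof.
move=> mf mg invg nnu fin; have veps := is_value_qVX hv nu.
set eps := Q ^- nu in veps *.
pose H w := approx_kernel q a eps (v (w - x)).
have [intHf TE] := Rfracdiff_Rriesz hv hmu a0 a1 veps mf fin.
have intH := approx_kernel_integrable x veps.
have HE := approx_kernel_integral x veps.
have intHx : mu.-integrable [set: K] (EFin \o (fun w => f x * H w)).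
  exact: integrable_scale.
have errE : Rerr f nu x = Rintegral mu [set: K] (fun w => H w * f w - f x * H w).
  by rewrite RintegralB// RintegralZl// HE mulr1 /Rerr TE.
have intd := integrable_diff intHf intHx.
have mh : measurable_fun [set: K] (fun w => f w - g w) by exact: measurable_funB.
have mnH : measurable_fun [set: K] (fun w => `|H w|).
  by apply: measurableT_comp => //; exact: measurable_kernel.
apply: (@le_trans _ _ (\int[mu]_w (`|H w| * `|f w - g w| + `|f x - g x| * `|H w|)%:E)%E).
  rewrite errE EFin_normr_Rintegral//.
  apply: le_trans (le_abse_integral mu measurableT (measurable_int mu intd)) _.
  apply: ge0_le_integral => //=.
  - by apply/measurable_EFinP; apply: measurableT_comp => //;
      move/measurable_int/measurable_EFinP : intd.
  - apply/measurable_EFinP; apply: measurable_funD; apply: measurable_funM => //.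
    exact: measurableT_comp.
  - move=> w _; rewrite lee_fin.
    have [we|we] := leP eps (v (w - x)).
      by rewrite /H approx_kernel_outside// mul0r mulr0 subr0 normr0 mul0r mulr0 addr0.
    have gwx : g w = g x by apply: (ball_invariantW hv nnu invg); exact: ltW.
    have -> : H w * f w - f x * H w = H w * ((f w - g w) - (f x - g x)).
      by rewrite gwx; ring.
    by rewrite normrM (mulrC `|f x - g x|) -mulrDr ler_wpM2l// ler_normB.
under eq_integral do rewrite EFinD.
rewrite ge0_integralD//; last 2 first.
- by apply/measurable_EFinP; apply: measurable_funM => //; exact: measurableT_comp.
- by apply/measurable_EFinP; apply: measurable_funM.
apply: leeD => //; under eq_integral do rewrite EFinM.
rewrite ge0_integralZl//; last exact/measurable_EFinP.
rewrite mulrC EFinM; apply: lee_wpmul2l => //.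
exact: approx_kernel_mass_le.
Qed.

(** [Rerr_pointwise] and the Schur test, applicable since the kernel is
    symmetric in its two arguments. *)
Lemma Rerr_bound (f g : K -> R) n nu :
  measurable_fun [set: K] f -> measurable_fun [set: K] g ->
  (\int[mu]_x (`|f x| `^ p)%:E < +oo)%E ->
  ball_invariant v q n g -> (n <= nu)%N ->
  (\int[mu]_x (`|Rerr f nu x| `^ p)%:E <=
   (2 `^ p * ((2 * approx_kernel_mass) `^ p + approx_kernel_mass `^ p))%:E *
     \int[mu]_x (`|f x - g x| `^ p)%:E)%E.
Proof.
move=> mf mg fp invg nnu; have veps := is_value_qVX hv nu.
have M0 := approx_kernel_mass_gt0.
pose h x := `|f x - g x|.
have mh : measurable_fun [set: K] h.
  by apply: measurableT_comp => //; exact: measurable_funB.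
have h0 x : 0 <= h x by exact: normr_ge0.
pose k (xw : K * K) := `|approx_kernel q a (Q ^- nu) (v (xw.1 - xw.2))|.
have mk : measurable_fun [set: K * K] k.
  apply: measurableT_comp => //.
  exact: (measurableT_comp (measurable_approx_kernel q a _) (measurable_absv_dist hv)).
have k0 xw : 0 <= k xw by exact: normr_ge0.
have kcol w : (\int[mu]_x (k (x, w))%:E <= approx_kernel_mass%:E)%E.
  exact: (approx_kernel_mass_le w veps).
have krow x : (\int[mu]_w (k (x, w))%:E <= approx_kernel_mass%:E)%E.
  by rewrite /k/=; under eq_integral do rewrite (absv_distC hv);
    exact: approx_kernel_mass_le.
have mkh : measurable_fun [set: K * K] (fun xw => (k xw * h xw.2)%:E).
  apply/measurable_EFinP; apply: measurable_funM => //; exact: (measurableT_comp mh).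
have kh0 xw : (0 <= (k xw * h xw.2)%:E)%E by rewrite lee_fin mulr_ge0.
pose J x := (\int[mu]_w (k (x, w) * h w)%:E)%E.
have mJ : measurable_fun [set: K] J.
  exact: (measurable_fun_fubini_tonelli_F (m2 := mu) _ mkh kh0).
have J0 x : (0 <= J x)%E by apply: integral_ge0 => w _; exact: (kh0 (x, w)).
have mJp : measurable_fun [set: K] (fun x => J x `^ p)%E.
  exact: (measurableT_comp (measurable_poweR p) mJ).
have mhp : measurable_fun [set: K] (fun x => (h x `^ p)%:E).
  by apply/measurable_EFinP; exact: (measurableT_comp (measurable_powR p)).
have merr := measurable_Rerr nu mf.
have mMhp : measurable_fun [set: K] (fun x => (approx_kernel_mass `^ p)%:E * (h x `^
  p)%:E)%E.
  exact: measurable_funeM.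
apply: (@le_trans _ _ (\int[mu]_x ((2 `^ p)%:E * (J x `^ p +
    (approx_kernel_mass `^ p)%:E * (h x `^ p)%:E)))%E).
  apply: ae_ge0_le_integral => //=.
  - exact: measurable_norm_powR.
  - move=> x _; apply: mule_ge0; first by rewrite lee_fin powR_ge0.
    apply: adde_ge0; first exact: poweR_ge0.
    by rewrite mule_ge0// lee_fin powR_ge0.
  - by apply: measurable_funeM; exact: emeasurable_funD.
  apply: filterS (riesz_ae_finite hv hmu a0 a1 p1 pa mf fp) => x Ux _.
  have := Rerr_pointwise mf mg invg nnu Ux.
  rewrite (_ : (\int[mu]_w _)%E = J x); last first.
    by apply: eq_integral => w _; rewrite /k/= (absv_distC hv).
  rewrite -/(h x); have := J0 x; case: (J x) => [j|_ _|//]; last first.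
    by rewrite poweRyr ?gt_eqF// addye// gt0_muley ?leey// lte_fin powR_gt0.
  move=> j0 ej; have {}j0 : 0 <= j by rewrite -lee_fin.
  have {}ej : `|Rerr f nu x| <= j + approx_kernel_mass * h x by rewrite -lee_fin EFinD.
  rewrite lee_fin.
  apply: (@le_trans _ _ ((j + approx_kernel_mass * h x) `^ p)).
    apply: ge0_ler_powR ej; rewrite ?nnegrE ?(ltW p0)//.
    by apply: addr_ge0 => //; apply: mulr_ge0; rewrite ?(ltW M0).
  have Mh0 : 0 <= approx_kernel_mass * h x by apply: mulr_ge0; rewrite ?(ltW M0).
  apply: le_trans (powRD_le (ltW p0) j0 Mh0) _.
  by rewrite powRM// ltW.
rewrite ge0_integralZl//; last 2 first.
- exact: emeasurable_funD.
- move=> x _; apply: adde_ge0; first exact: poweR_ge0.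
  by rewrite mule_ge0// lee_fin powR_ge0.
rewrite ge0_integralD//; last 2 first.
- by move=> x _; exact: poweR_ge0.
- by move=> x _; rewrite mule_ge0// lee_fin powR_ge0.
rewrite ge0_integralZl//; last 2 first.
- by move=> x _; rewrite lee_fin powR_ge0.
- by rewrite lee_fin powR_ge0.
rewrite EFinM -muleA; apply: lee_wpmul2l => //.
rewrite EFinD ge0_muleDl ?lee_fin ?powR_ge0//; apply: leeD => //.
exact: (schur_test p1 M0 mk k0 krow kcol mh h0).
Qed.

(** The case g = 0 of [Rerr_bound]. *)
Lemma Rerr_Lp (f : K -> R) nu : measurable_fun [set: K] f ->
  (\int[mu]_x (`|f x| `^ p)%:E < +oo)%E ->
  (\int[mu]_x (`|Rerr f nu x| `^ p)%:E < +oo)%E.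
Proof.
move=> mf fp.
have := @Rerr_bound f (fun=> 0) 0 nu mf (measurable_cst _) fp _ (leq0n _).
move=> /(_ (fun _ _ _ => erefl)) /le_lt_trans; apply.
apply: lte_mul_pinfty; [|by []|].
- by rewrite lee_fin mulr_ge0 ?addr_ge0 ?powR_ge0.
- by under eq_integral do rewrite subr0.
Qed.

Lemma Rerr_cvg0 (f : K -> R) (e : R) : measurable_fun [set: K] f ->
  (\int[mu]_x (`|f x| `^ p)%:E < +oo)%E -> 0 < e ->
  exists N, forall nu, (N <= nu)%N ->
    (\int[mu]_x (`|Rerr f nu x| `^ p)%:E <= e%:E)%E.
Proof.
move=> mf fp e0; set C := 2 `^ p * ((2 * approx_kernel_mass) `^ p +
  approx_kernel_mass `^ p).
have C0 : 0 < C.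
  have M0 := approx_kernel_mass_gt0; apply: mulr_gt0; first exact: powR_gt0.
  by apply: addr_gt0; apply: powR_gt0 => //; apply: mulr_gt0.
have [_ /(_ _ (divr_gt0 e0 C0))[n [g [mg invg fg]]]] := Lp_density hv hmu p1 mf fp.
exists n => nu nnu; apply: le_trans (Rerr_bound mf mg fp invg nnu) _.
apply: (@le_trans _ _ (C%:E * (e / C)%:E)%E).
  by apply: lee_wpmul2l => //; rewrite lee_fin ltW.
by rewrite -EFinM lee_fin mulrC divfK// gt_eqF.
Qed.

End ErrorBound.
End ApproxIdentity.

(** * Complex-valued functions *)

(** Fubini's theorem asks for a bundled sigma-finite measure;
    bundling does not change the underlying measure. *)
Lemma sigma_finite_measure_exists (R : realType) (d : measure_display)
    (T : measurableType d) (mu : {measure set T -> \bar R}) :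
  sigma_finite [set: T] mu ->
  exists mu' : {sigma_finite_measure set T -> \bar R},
    (mu' : {measure set T -> \bar R}) = mu.
Proof.
move=> sf.
pose sfin := isSFinite.Build d T R mu (sfinite_measure_sigma_finite sf).
pose sigma := isSigmaFinite.Build d T R mu sf.
pose mu' : {sigma_finite_measure set T -> \bar R} :=
  HB.pack (Measure.sort mu) sfin sigma.
exists mu'; rewrite /mu' {mu'} /sfin {sfin} /sigma {sigma}.
by case: mu sf => s c sf; case: c sf.
Qed.

Section ComplexParts.
Context {R : realType}.
Implicit Types z : R[i].
Local Open Scope complex_scope.

Lemma Re_realM (k : R) z : complex.Re (k%:C * z) = k * complex.Re z.
Proof. by case: z => x y /=; rewrite mul0r subr0. Qed.

Lemma Im_realM (k : R) z : complex.Im (k%:C * z) = k * complex.Im z.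
Proof. by case: z => x y /=; rewrite mul0r addr0. Qed.

Lemma ReB z z' : complex.Re (z - z') = complex.Re z - complex.Re z'.
Proof. by case: z z' => [? ?] [? ?]. Qed.

Lemma ImB z z' : complex.Im (z - z') = complex.Im z - complex.Im z'.
Proof. by case: z z' => [? ?] [? ?]. Qed.

Lemma Re_divr z (k : R) : complex.Re (z / k%:C) = complex.Re z / k.
Proof. by rewrite -fmorphV mulrC Re_realM mulrC. Qed.

Lemma Im_divr z (k : R) : complex.Im (z / k%:C) = complex.Im z / k.
Proof. by rewrite -fmorphV mulrC Im_realM mulrC. Qed.

Lemma normc_ge0 z : 0 <= Normc.normc z.
Proof. by case: z => x y /=; exact: sqrtr_ge0. Qed.

Lemma norm_Re_le z : `|complex.Re z| <= Normc.normc z.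
Proof. by case: z => x y /=; rewrite -sqrtr_sqr ler_wsqrtr// lerDl sqr_ge0. Qed.

Lemma norm_Im_le z : `|complex.Im z| <= Normc.normc z.
Proof. by case: z => x y /=; rewrite -sqrtr_sqr ler_wsqrtr// lerDr sqr_ge0. Qed.

Lemma normc_le z : Normc.normc z <= `|complex.Re z| + `|complex.Im z|.
Proof.
case: z => x y /=; rewrite -[leRHS]ger0_norm ?addr_ge0// -sqrtr_sqr.
rewrite ler_wsqrtr// sqrrD !real_normK ?num_real//.
by rewrite -addrA [X in _ <= _ + X]addrC addrA lerDl mulrn_wge0// mulr_ge0.
Qed.

End ComplexParts.

Section ComplexLp.
Context {R : realType} {d : measure_display} {T : measurableType d}.
Variables (mu : {measure set T -> \bar R}) (p : R).
Hypothesis p1 : 1 <= p.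

Let p0 : 0 < p. Proof. exact: lt_le_trans p1. Qed.

Lemma CLnormE (f : T -> R[i]) :
  CLnorm mu p f = ((\int[mu]_x (Normc.normc (f x) `^ p)%:E) `^ p^-1)%E.
Proof.
rewrite /CLnorm unlock; congr (_ `^ _)%E; apply: eq_integral => x _ /=.
by rewrite ger0_norm// normc_ge0.
Qed.

Lemma measurable_normc_powR (f : T -> R[i]) :
  measurable_fun [set: T] (fun t => complex.Re (f t)) ->
  measurable_fun [set: T] (fun t => complex.Im (f t)) ->
  measurable_fun [set: T] (fun x => (Normc.normc (f x) `^ p)%:E).
Proof.
move=> mRe mIm; apply/measurable_EFinP; apply: (measurableT_comp (measurable_powR p)).
rewrite (_ : (fun _ => _) =
  (fun x => (complex.Re (f x) ^+ 2 + complex.Im (f x) ^+ 2) `^ 2^-1)).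
  apply: (measurableT_comp (measurable_powR _)).
  by apply: measurable_funD; exact: measurable_funX.
apply/funext => x; rewrite powR12_sqrt ?addr_ge0 ?sqr_ge0//.
by case: (f x).
Qed.

Lemma CLp_parts (f : T -> R[i]) : CLp mu p f ->
  (\int[mu]_x (`|complex.Re (f x)| `^ p)%:E < +oo)%E /\
  (\int[mu]_x (`|complex.Im (f x)| `^ p)%:E < +oo)%E.
Proof.
move=> [mRe mIm]; rewrite CLnormE => /lty_poweRy fin.
have {}fin : (\int[mu]_x (Normc.normc (f x) `^ p)%:E < +oo)%E.
  by apply: fin; rewrite invr_eq0 gt_eqF.
split; apply: le_lt_trans fin; apply: ge0_le_integral => //.
- exact: measurable_norm_powR.
- exact: measurable_normc_powR.
- move=> x _; rewrite lee_fin; apply: ge0_ler_powR;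
    rewrite ?nnegrE ?normc_ge0 ?(ltW p0)//.
  exact: norm_Re_le.
- exact: measurable_norm_powR.
- exact: measurable_normc_powR.
- move=> x _; rewrite lee_fin; apply: ge0_ler_powR;
    rewrite ?nnegrE ?normc_ge0 ?(ltW p0)//.
  exact: norm_Im_le.
Qed.

Lemma CLnorm_powR_le (f : T -> R[i]) :
  measurable_fun [set: T] (fun t => complex.Re (f t)) ->
  measurable_fun [set: T] (fun t => complex.Im (f t)) ->
  (\int[mu]_x (Normc.normc (f x) `^ p)%:E <= (2 `^ p)%:E *
    (\int[mu]_x (`|complex.Re (f x)| `^ p)%:E +
     \int[mu]_x (`|complex.Im (f x)| `^ p)%:E))%E.
Proof.
move=> mRe mIm.
have mRep := measurable_norm_powR p mRe; have mImp := measurable_norm_powR p mIm.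
rewrite -ge0_integralD//= -ge0_integralZl//; last 2 first.
- exact: emeasurable_funD.
- by move=> x _; rewrite -EFinD lee_fin addr_ge0 ?powR_ge0.
apply: ge0_le_integral => //.
- by move=> x _; rewrite lee_fin powR_ge0.
- exact: measurable_normc_powR.
- by apply: measurable_funeM; exact: emeasurable_funD.
- move=> x _; rewrite -EFinD -EFinM lee_fin.
  apply: le_trans (powRD_le (ltW p0) (normr_ge0 _) (normr_ge0 _)).
  apply: ge0_ler_powR; rewrite ?nnegrE ?addr_ge0 ?normc_ge0 ?(ltW p0)//.
  exact: normc_le.
Qed.

End ComplexLp.

Lemma ereal_cvg0 (R : realType) (u : nat -> \bar R) : (forall n, 0 <= u n)%E ->
  (forall e : R, 0 < e -> exists N, forall n, (N <= n)%N -> (u n <= e%:E)%E) ->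
  u @ \oo --> 0%E.
Proof.
move=> u0 hu; have ufin n e : (u n <= e%:E)%E -> u n \is a fin_num.
  by move=> une; rewrite ge0_fin_numE// (le_lt_trans une)// ltry.
apply/fine_cvgP; split.
  by have [N hN] := hu 1 ltr01; exists N => // n /hN; exact: ufin.
apply/cvgr0Pnorm_le => e e0; have [N hN] := hu e e0; exists N => // n /= /hN une.
by rewrite ger0_norm ?fine_ge0// -lee_fin fineK// (ufin _ _ une).
Qed.

Section Parts.
Context {R : realType} {K : nonarchLocalFieldType}.
Variables (v : K -> R) (q : nat) (mu : {sigma_finite_measure set K -> \bar R}) (a : R).

Lemma Re_riesz_potential (phi : K -> R[i]) x :
  complex.Re (riesz_potential v q mu a phi x) =
    Rriesz v q mu a (fun t => complex.Re (phi t)) x.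
Proof.
rewrite /riesz_potential Re_realM /Rriesz /Cintegral /=; congr (_ * Rintegral _ _ _).
by apply/funext => y; rewrite Re_realM.
Qed.

Lemma Im_riesz_potential (phi : K -> R[i]) x :
  complex.Im (riesz_potential v q mu a phi x) =
    Rriesz v q mu a (fun t => complex.Im (phi t)) x.
Proof.
rewrite /riesz_potential Im_realM /Rriesz /Cintegral /=; congr (_ * Rintegral _ _ _).
by apply/funext => y; rewrite Im_realM.
Qed.

Lemma Re_truncated_fracdiff eps (u : K -> R[i]) x :
  complex.Re (truncated_fracdiff v q mu a eps u x) =
  Rfracdiff v q mu a eps (fun t => complex.Re (u t)) x.
Proof.
rewrite /truncated_fracdiff Re_realM /Rfracdiff /Cintegral /=.
congr (_ * Rintegral _ _ _); apply/funext => y; by rewrite Re_divr ReB.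
Qed.

Lemma Im_truncated_fracdiff eps (u : K -> R[i]) x :
  complex.Im (truncated_fracdiff v q mu a eps u x) =
  Rfracdiff v q mu a eps (fun t => complex.Im (u t)) x.
Proof.
rewrite /truncated_fracdiff Im_realM /Rfracdiff /Cintegral /=.
congr (_ * Rintegral _ _ _); apply/funext => y; by rewrite Im_divr ImB.
Qed.

End Parts.

Theorem theorem1 (R : realType) (K : nonarchLocalFieldType)
  (v : K -> R) (q : nat) (mu : {measure set K -> \bar R})
  (hv : normalized_absolute_value v q) (hmu : normalized_haar_measure v mu)
  (alpha p : R) (halpha0 : 0 < alpha) (halpha1 : alpha < 1)
  (hp1 : 1 <= p) (hpalpha : p < 1 / alpha)
  (phi : K -> R[i]) (hphi : CLp mu p phi) :
  let err (nu : nat) (x : K) : R[i] :=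
    truncated_fracdiff v q mu alpha (q%:R ^- nu)
      (riesz_potential v q mu alpha phi) x - phi x in
  (forall nu : nat, CLp mu p (err nu)) /\
  (fun nu : nat => CLnorm mu p (err nu)) @ \oo --> 0%E.
Proof.
have [mu' mu'E] := sigma_finite_measure_exists (haar_sigma_finite hv hmu).
subst mu; have p0 : 0 < p by exact: lt_le_trans hp1.
move=> err.
have ReE nu : (fun t => complex.Re (err nu t)) =
  Rerr v q mu' alpha (fun t => complex.Re (phi t)) nu.
  apply/funext => x; rewrite /err ReB Re_truncated_fracdiff /Rerr.
  by congr (Rfracdiff _ _ _ _ _ _ _ - _); apply/funext => y; exact: Re_riesz_potential.
have ImE nu : (fun t => complex.Im (err nu t)) =
  Rerr v q mu' alpha (fun t => complex.Im (phi t)) nu.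
  apply/funext => x; rewrite /err ImB Im_truncated_fracdiff /Rerr.
  by congr (Rfracdiff _ _ _ _ _ _ _ - _); apply/funext => y; exact: Im_riesz_potential.
have [mRe mIm _] := hphi; have [finRe finIm] := CLp_parts hp1 hphi.
have mReerr nu : measurable_fun [set: K] (fun t => complex.Re (err nu t)).
  by rewrite ReE; exact: (measurable_Rerr hv).
have mImerr nu : measurable_fun [set: K] (fun t => complex.Im (err nu t)).
  by rewrite ImE; exact: (measurable_Rerr hv).
have int_err nu : (\int[mu']_x (Normc.normc (err nu x) `^ p)%:E <= (2 `^ p)%:E *
    (\int[mu']_x (`|Rerr v q mu' alpha (fun t => complex.Re (phi t)) nu x| `^ p)%:E +
     \int[mu']_x (`|Rerr v q mu' alpha (fun t => complex.Im (phi t)) nu x| `^ p)%:E))%E.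
  by rewrite -ReE -ImE; exact: CLnorm_powR_le.
have fin_err nu : (\int[mu']_x (Normc.normc (err nu x) `^ p)%:E < +oo)%E.
  apply: le_lt_trans (int_err nu) _; apply: lte_mul_pinfty => //.
  by apply: lte_add_pinfty; exact: (Rerr_Lp hv hmu halpha0 halpha1 hp1 hpalpha).
split=> [nu|].
  split; [exact: mReerr|exact: mImerr|].
  by rewrite CLnormE; exact: poweR_lty.
apply: ereal_cvg0 => [nu|e e0]; first by rewrite CLnormE poweR_ge0.
(* Chosen so that 2^p (dlt + dlt) = e^p. *)
pose dlt := e `^ p / 2 `^ p / 2.
have dlt0 : 0 < dlt by rewrite !divr_gt0 ?powR_gt0.
have [N1 hN1] := Rerr_cvg0 hv hmu halpha0 halpha1 hp1 hpalpha mRe finRe dlt0.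
have [N2 hN2] := Rerr_cvg0 hv hmu halpha0 halpha1 hp1 hpalpha mIm finIm dlt0.
exists (maxn N1 N2) => nu; rewrite geq_max => /andP[/hN1 nu1 /hN2 nu2].
have le_ep : (\int[mu']_x (Normc.normc (err nu x) `^ p)%:E <= (e `^ p)%:E)%E.
  apply: le_trans (int_err nu) _.
  apply: (@le_trans _ _ ((2 `^ p)%:E * (dlt%:E + dlt%:E))%E).
    by apply: lee_wpmul2l; [rewrite lee_fin powR_ge0|exact: leeD nu1 nu2].
  by rewrite -EFinD -EFinM lee_fin /dlt -splitr mulrC divfK// gt_eqF// powR_gt0.
rewrite CLnormE; apply: (@le_trans _ _ ((e `^ p)%:E `^ p^-1)%E).
  apply: gt0_ler_poweR => //.
  - by rewrite invr_ge0 ltW.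
  - by rewrite in_itv/= leey andbT; apply: integral_ge0 => x _; rewrite lee_fin powR_ge0.
  - by rewrite in_itv/= leey andbT lee_fin powR_ge0.
by rewrite poweR_EFin -powRrM mulfV ?gt_eqF// powRr1// ltW.
Qed.
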